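(* Let $d\ge2$. (i) If $D_1\subset D_2\subset\mathbb{R}^d$ are open nonempty bounded convex sets, then $\Lambda_S(D_1)\ge\Lambda_S(D_2)$. (ii) For any open nonempty bounded convex set $D\subset\mathbb{R}^d$ and $s>0$ we have $\Lambda_S(sD)=s^{-1/2}\Lambda_S(D)$.
   Context: For $d\ge2$, $D\subset\mathbb{R}^d$ open nonempty bounded convex and $\lambda>0$: for a nonempty compact set $K\subset D$ let $v_K:\overline{D}\times\mathbb{R}\to[0,1]$ be the solution of $\Delta v_K=0$ in $(D\times\mathbb{R})\setminus(K\times\{0\})$, $v_K=0$ on $\partial D\times\mathbb{R}$, $v_K=1$ in $K\times\{0\}$. Write $K\in\mathcal{F}(D,\lambda)$ iff $\sup_{y\in D\setminus K}\frac{|v_K(y,0)-1|}{\delta_K^{1/2}(y)}\le\lambda$, where $\delta_K(y)=\operatorname{dist}(y,K)$. Bernoulli constant of $D$ for the spectral half Laplacian: $\Lambda_S(D)=\inf\{\lambda>0:\mathcal{F}(D,\lambda)\text{ is not empty}\}$. *)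

(* Defs.v *)
From HB Require Import structures.
From mathcomp Require Import all_boot all_order all_algebra.
From mathcomp Require Import all_classical all_reals all_analysis.

Set Implicit Arguments.
Unset Strict Implicit.
Unset Printing Implicit Defensive.

Import Order.TTheory GRing.Theory Num.Theory.
Import numFieldNormedType.Exports.

Local Open Scope classical_set_scope.
Local Open Scope ring_scope.

(* The library norm on 'rV[R]_d is the sup norm; it has the right topology but
   the distance to K must be Euclidean. *)
Definition enorm (R : realType) (d : nat) (x : 'rV[R]_d) : R :=
  Num.sqrt (\sum_(i < d) x ord0 i ^+ 2).

Definition edistance (R : realType) (d : nat) (y : 'rV[R]_d)
    (K : set 'rV[R]_d) : R :=
  inf [set enorm (y - x) | x in K].

Definition bounded_convex_domain (R : realType) (d : nat)
    (D : set 'rV[R]_d) : Prop :=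
  [/\ open D, D !=set0, bounded_set D & convex_set D].

(* C^2 on an open set U: all directional derivatives of order at most 2 exist
   on U and those of order 2 are continuous there (this already forces f and
   its first derivatives to be continuous on U). *)
Definition C2_on (R : realType) (V : normedModType R) (U : set V)
    (f : V -> R) : Prop :=
  forall p, U p -> forall u w : V,
    [/\ derivable f p u, derivable ('D_u f) p w
      & {for p, continuous ('D_w ('D_u f))}].

(* R^d x R is the product type 'rV[R]_d * R. *)
Definition laplacian (R : realType) (d : nat) (f : 'rV[R]_d * R -> R)
    (p : 'rV[R]_d * R) : R :=
  \sum_(i < d) 'D_(delta_mx ord0 i, 0) ('D_(delta_mx ord0 i, 0) f) p
  + 'D_(0, 1) ('D_(0, 1) f) p.

(* v is the function v_K.  Only the values of v on closure D x R are
   constrained.  Continuity up to the boundary gives its meaning to "v takes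
   the boundary values"; together with 0 <= v <= 1 it makes v unique on
   closure D x R. *)
Definition is_vK (R : realType) (d : nat) (D K : set 'rV[R]_d)
    (v : 'rV[R]_d * R -> R) : Prop :=
  let U := (D `*` [set: R]) `\` (K `*` [set 0]) in
  [/\ (forall p, (closure D `*` [set: R]) p -> 0 <= v p <= 1),
      {within closure D `*` [set: R], continuous v},
      C2_on U v /\ (forall p, U p -> laplacian v p = 0),
      (forall p, ((closure D `\` D) `*` [set: R]) p -> v p = 0)
    & (forall p, (K `*` [set 0]) p -> v p = 1)].

(* If K has irregular points then v_K exists only as a generalized solution,
   which is not continuous at K x {0}; the supremum is then +oo.  So asking for
   a classical solution does not change the class. *)
Definition classF (R : realType) (d : nat) (D : set 'rV[R]_d) (lambda : R) :
    set (set 'rV[R]_d) :=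
  [set K | [/\ K !=set0, compact K, K `<=` D
    & exists v, is_vK D K v /\
        (ereal_sup [set (`|v (y, 0%R) - 1| / edistance y K `^ 2^-1)%:E
                   | y in D `\` K] <= lambda%:E)%E]].

(* Extended-real infimum: the infimum of the empty set is +oo, not the default
   value 0 of the real-valued inf. *)
Definition LambdaS (R : realType) (d : nat) (D : set 'rV[R]_d) : \bar R :=
  ereal_inf [set lambda%:E | lambda in
    [set lambda : R | 0 < lambda /\ classF D lambda !=set0]].

(* Main.v *)
(* The case (i) amounts to the existence of v_K for the larger domain, with v_K on
   D2 at least v_K on D1; this is Perron's method, run on functions on R^d x R that
   are only required to satisfy the 2(d+1)-point mean value property with step h.  At
   this level a supremum of subsolutions is a solution, and a maximum principle holds
   on any set that is bounded in one direction, without attaining maxima.  A truncation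
   of v_K on D1 minus a small superharmonic function growing in t is a subsolution for
   small h; the distance to the complement of D2 is concave, hence superharmonic, and
   bounds the solutions near the boundary of D2.  Interior bounds for difference
   quotients of all orders, uniform in h, come from comparing odd parts with a quadratic
   polynomial, so the limit along an ultrafilter h -> 0 is C^2 and harmonic.  Finally, a
   point y outside D1 satisfies 1 <= lambda * dist(y, K)^(1/2), because v_K on D1
   vanishes where the segment from K to y leaves D1. *)

Require Import Defs.
From HB Require Import structures.
From mathcomp Require Import all_boot all_order all_algebra.
From mathcomp Require Import all_classical all_reals all_analysis.
From mathcomp Require Import ring lra.

Set Implicit Arguments.
Unset Strict Implicit.
Unset Printing Implicit Defensive.

Import Order.TTheory GRing.Theory Num.Theory.
Import numFieldNormedType.Exports.

Local Open Scope classical_set_scope.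
Local Open Scope ring_scope.

(** * Coordinates on R^d x R *)

(** The discretisation lives at every point of R^d x R instead of on a lattice, so no domain has to
    be approximated and every function, however irregular, may compete: pointwise suprema are again
    competitors. The price is that discrete solutions may be discontinuous, and their estimates
    compare only points that differ by whole steps h along the axes. Hence two devices in the limit:
    the functions are sampled at p rounded down to the lattice of mesh h, so that two samples differ
    by whole steps, and an ultrafilter gives convergence at all points at once, where extracting a
    subsequence would call for equicontinuity. Bounds up to third order are the cost of C^2: they
    make the second difference quotients Lipschitz in the limit.

    At K x {0} no barrier is built and no regularity of K enters: v_K on D1 bounds the new solution
    from below, 1 from above, and the two meet there. The discrete equation is imposed only away
    from a neighbourhood of K x {0} whose radius tends to 0 with h, because the error of the
    discrete Laplacian on v_K is controlled uniformly only at a positive distance from K x {0}. *)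

Section Coordinates.
Variables (R : realType) (d : nat).
Implicit Types (i j : option 'I_d) (x y : 'rV[R]_d * R).

(** [Some k] indexes the k-th axis of R^d and [None] the axis of t, so one sum over [option 'I_d]
    runs over all d+1 directions. *)
Definition ev i : 'rV[R]_d * R :=
  if i is Some k then (delta_mx ord0 k, 0) else (0, 1).

Definition co i x : R := if i is Some k then x.1 ord0 k else x.2.

Lemma coD i x y : co i (x + y) = co i x + co i y.
Proof. by case: i => [k|] //=; rewrite mxE. Qed.

Lemma coN i x : co i (- x) = - co i x.
Proof. by case: i => [k|] //=; rewrite mxE. Qed.

Lemma coB i x y : co i (x - y) = co i x - co i y.
Proof. by rewrite coD coN. Qed.

Lemma coZ i a x : co i (a *: x) = a * co i x.
Proof. by case: i => [k|] //=; rewrite mxE. Qed.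

Lemma co0 i : co i 0 = 0.
Proof. by case: i => [k|] //=; rewrite mxE. Qed.

Lemma co_ev i j : co i (ev j) = (i == j)%:R.
Proof.
case: i j => [k|] [l|] //=; rewrite mxE //.
Qed.

Definition coE := (coD, coN, coZ, co_ev, co0).

Lemma co_inj x y : (forall i, co i x = co i y) -> x = y.
Proof.
case: x y => x1 x2 [y1 y2] xy; congr pair; last exact: (xy None).
by apply/rowP => k; exact: (xy (Some k)).
Qed.

Lemma co_sumr (s : seq (option 'I_d)) i (w : option 'I_d -> 'rV[R]_d * R) :
  co i (\sum_(j <- s) w j) = \sum_(j <- s) co i (w j).
Proof. by elim/big_rec2: _ => [|j a b _ <-]; rewrite !coE. Qed.

Lemma co_basis x : \sum_i co i x *: ev i = x.
Proof.
apply: co_inj => i; rewrite co_sumr (bigD1 i) //= !coE eqxx mulr1 big1 ?addr0//.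
by move=> j ji; rewrite !coE eq_sym (negbTE ji) mulr0.
Qed.

Lemma norm_co i x : `|co i x| <= `|x|.
Proof.
rewrite prod_normE; case: i => [k|] /=; rewrite le_max ?lexx ?orbT //.
apply/orP; left; rewrite [leRHS]/Num.norm /= mx_normrE.
exact: (le_bigmax _ (fun ij => `|x.1 ij.1 ij.2|) (ord0, k)).
Qed.

Lemma norm_ltP (r : R) x : 0 < r -> (forall i, `|co i x| < r) -> `|x| < r.
Proof.
move=> r0 xr; rewrite prod_normE gt_max (xr None) andbT.
rewrite [ltLHS]/Num.norm /= mx_normrE.
apply: bigmax_lt => // -[a k] _ /=; rewrite (ord1 a); exact: (xr (Some k)).
Qed.

Lemma norm_leP (r : R) x : 0 <= r -> (forall i, `|co i x| <= r) -> `|x| <= r.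
Proof.
move=> r0 xr; rewrite prod_normE ge_max (xr None) andbT.
rewrite [leLHS]/Num.norm /= mx_normrE.
apply: bigmax_le => // -[a k] _ /=; rewrite (ord1 a); exact: (xr (Some k)).
Qed.

Lemma norm_ev i : `|ev i| <= 1 :> R.
Proof. by apply: norm_leP => // j; rewrite co_ev; case: (_ == _); rewrite ?normr1 ?normr0. Qed.

Lemma norm_ev_scale (a : R) i : `|a *: ev i| <= `|a|.
Proof. by rewrite normrZ ler_piMr ?norm_ev. Qed.

End Coordinates.

(** * The discrete Laplacian and its maximum principle *)

Section DiscreteLaplacian.
Variables (R : realType) (d : nat).
Local Notation V := ('rV[R]_d * R)%type.
Implicit Types (i j : option 'I_d) (x y z : V) (h : R) (f g : V -> R) (Q : set V).

(** Not divided by h^2, so a quadratic polynomial gives its Laplacian times h^2. *)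
Definition dlap h f x : R :=
  \sum_i (f (x + h *: ev R i) + f (x - h *: ev R i) - 2 * f x).

Definition neighbor h x y :=
  exists i, y = x + h *: ev R i \/ y = x - h *: ev R i.

Lemma neighborD h x i : neighbor h x (x + h *: ev R i).
Proof. by exists i; left. Qed.

Lemma neighborB h x i : neighbor h x (x - h *: ev R i).
Proof. by exists i; right. Qed.

Lemma neighbor_co h x y i : 0 < h -> neighbor h x y -> `|co i y| <= `|co i x| + h.
Proof.
move=> h0 [j [] ->]; rewrite !coE (le_trans (ler_normD _ _))// lerD2l ?normrN;
  by case: (_ == _); rewrite ?mulr1 ?mulr0 ?normr0 ?gtr0_norm // ltW.
Qed.

Lemma neighbor_dist h x y : 0 < h -> neighbor h x y -> `|y - x| <= h.
Proof.
move=> h0 [j [] ->]; rewrite addrAC subrr add0r ?normrN;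
  by rewrite (le_trans (norm_ev_scale _ _)) ?gtr0_norm.
Qed.

Lemma sum_dir_const (a : R) : \sum_(i : option 'I_d) a = d.+1%:R * a.
Proof. by rewrite sumr_const card_option card_ord mulr_natl. Qed.

Lemma dlap_lin h (a b : R) f g x :
  dlap h (fun y => a * f y + b * g y) x = a * dlap h f x + b * dlap h g x.
Proof.
rewrite /dlap !mulr_sumr -big_split /=; apply: eq_bigr => i _; ring.
Qed.

Lemma dlap_cst h (a : R) x : dlap h (fun=> a) x = 0.
Proof. by rewrite /dlap big1 // => i _; ring. Qed.

Lemma dlap_co h i z x : dlap h (fun y => co i (y - z)) x = 0.
Proof. by rewrite /dlap big1 // => j _; rewrite !coE; move: (_%:R) => b; ring. Qed.

Lemma dlap_co_sqr h i z x : dlap h (fun y => co i (y - z) ^+ 2) x = 2 * h ^+ 2.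
Proof.
rewrite /dlap (bigD1 i) //= big1 => [|j ji]; rewrite !coE ?eqxx /=.
  by ring.
by rewrite eq_sym (negbTE ji) /=; ring.
Qed.

Lemma dlap_sum h (F : option 'I_d -> V -> R) x :
  dlap h (fun y => \sum_i F i y) x = \sum_i dlap h (F i) x.
Proof.
rewrite /dlap exchange_big; apply: eq_bigr => i _ /=.
by rewrite big_split big_split /= sumrN mulr_sumr.
Qed.

Lemma dlap_le h f g x : f x = g x -> (forall y, neighbor h x y -> f y <= g y) ->
  dlap h f x <= dlap h g x.
Proof.
move=> fg nfg; apply: ler_sum => i _; rewrite fg lerD2r.
by rewrite lerD // nfg //; [exact: neighborD|exact: neighborB].
Qed.

(* Adding a multiple of (co i0)^2 makes f strictly subharmonic, so that a point where
   f is close enough to its supremum already gives a contradiction. *)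
Lemma discrete_max_principle h Q f i0 (B M : R) : 0 < h ->
  (forall x, Q x -> `|co i0 x| <= B) -> (forall x, Q x -> f x <= M) ->
  (forall x, Q x -> 0 < f x -> 0 <= dlap h f x) ->
  (forall x y, Q x -> 0 < f x -> neighbor h x y -> Q y \/ f y <= 0) ->
  forall x, Q x -> f x <= 0.
Proof.
move=> h0 QB QM Qf Qn x0 Qx0; rewrite leNgt; apply/negP => fx0.
have Bh : 0 < B + h by rewrite ltr_wpDl // (le_trans _ (QB _ Qx0)).
(* The correction takes away at most f x0 / 2 at x0, so g stays positive there; B + h instead of B
   keeps g below f also at the neighbours of points of Q. *)
pose e := f x0 / (2 * (B + h) ^+ 2).
have e0 : 0 < e by rewrite divr_gt0 // mulr_gt0 // exprn_gt0.
have eE : e * (B + h) ^+ 2 = f x0 / 2 by rewrite /e; field; rewrite lt0r_neq0.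
pose g y := f y + e * (co i0 y ^+ 2 - (B + h) ^+ 2).
have gf y : `|co i0 y| <= B + h -> g y <= f y.
  move=> yB; rewrite gerDl pmulr_rle0 // subr_le0 -real_normK ?num_real //.
  by rewrite lerXn2r // nnegrE ltW.
have gx0 : 0 < g x0.
  by rewrite /g mulrBr eE; have := mulr_ge0 (ltW e0) (sqr_ge0 (co i0 x0)); lra.
have Bh' : B <= B + h by rewrite lerDl ltW.
have gsup : has_sup (g @` Q).
  split; first by exists (g x0), x0.
  exists M => _ [y Qy <-]; apply: le_trans (QM _ Qy); apply: gf.
  exact: le_trans (QB _ Qy) Bh'.
set S := sup (g @` Q).
have gS y : Q y -> g y <= S by move=> Qy; apply: ub_le_sup (imageP _ Qy); case: gsup.
(* The first bound makes 2 (d+1) (S - g x) smaller than the gain 2 e h^2; the second gives g x > S -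
   g x0 >= 0, so that f x > 0 and the hypotheses apply at x. *)
pose t := Num.min (e * h ^+ 2 / d.+1%:R) (g x0).
have t0 : 0 < t by rewrite lt_min gx0 divr_gt0 // mulr_gt0 // exprn_gt0.
have [_ [x Qx <-] xS] := sup_adherent t0 gsup; rewrite -/S in xS.
have gx : 0 < g x.
  have : t <= g x0 by rewrite ge_min lexx orbT.
  by have := gS _ Qx0; lra.
have fx : 0 < f x by apply: lt_le_trans gx (gf _ (le_trans (QB _ Qx) Bh')).
have nS y : neighbor h x y -> g y <= S.
  move=> xy; have [Qy|fy] := Qn _ _ Qx fx xy; first exact: gS.
  apply: le_trans (le_trans (gf y _) fy) _.
    by apply: le_trans (neighbor_co _ h0 xy) _; rewrite lerD2r QB.
  exact: le_trans (ltW gx) (gS _ Qx).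
have : dlap h g x <= \sum_(i : option 'I_d) (2 * (S - g x)).
  apply: ler_sum => i _.
  by have := nS _ (neighborD h x i); have := nS _ (neighborB h x i); lra.
have -> : dlap h g x = dlap h f x + 2 * e * h ^+ 2.
  have -> : g = fun y => 1 * f y + e * (1 * co i0 (y - 0) ^+ 2 + (- (B + h) ^+ 2) * 1).
    by apply/funext => y; rewrite /g subr0; ring.
  by rewrite dlap_lin dlap_lin dlap_co_sqr dlap_cst; ring.
rewrite sum_dir_const.
have : d.+1%:R * (S - g x) < e * h ^+ 2.
  rewrite mulrC -ltr_pdivlMr //; have : t <= e * h ^+ 2 / d.+1%:R by rewrite ge_min lexx.
  set E := (_ / _) => tE; apply: lt_le_trans tE; rewrite ltrBlDl -ltrBlDr; exact: xS.
by have := Qf _ Qx fx; lra.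
Qed.
End DiscreteLaplacian.

(** * Interior difference estimates *)

Section DifferenceEstimate.
Variables (R : realType) (d : nat).
Local Notation V := ('rV[R]_d * R)%type.
Local Notation n := (d.+1%:R : R).
Implicit Types (i j : option 'I_d) (x y z : V) (h r M : R) (f g : V -> R).

Definition reflect_at j z y : V := y - (2 * co j (y - z)) *: ev R j.

Lemma co_reflect j z y i :
  co i (reflect_at j z y - z) = (if i == j then -1 else 1) * co i (y - z).
Proof. by rewrite !coE; case: eqP => [->|_] /=; ring. Qed.

Lemma reflect_atK j z : involutive (reflect_at j z).
Proof.
move=> y; apply: co_inj => i; apply: (addIr (- co i z)); rewrite -!coB.
by rewrite !co_reflect; case: ifP => _; ring.
Qed.

(** The reflection swaps the two neighbours in direction j and commutes with the steps in all other
    directions. *)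
Lemma dlap_reflect h f j z y :
  dlap h (f \o reflect_at j z) y = dlap h f (reflect_at j z y).
Proof.
rewrite /dlap; apply: eq_bigr => i _ /=.
have [<-|ij] := eqVneq i j.
  have -> : reflect_at i z (y + h *: ev R i) = reflect_at i z y - h *: ev R i.
    by apply: co_inj => k; rewrite !coE eqxx /=; move: (_%:R) => b; ring.
  have -> : reflect_at i z (y - h *: ev R i) = reflect_at i z y + h *: ev R i.
    by apply: co_inj => k; rewrite !coE eqxx /=; move: (_%:R) => b; ring.
  by rewrite [f _ + _]addrC.
have shift a : reflect_at j z (y + a *: ev R i) = reflect_at j z y + a *: ev R i.
  apply: co_inj => k; rewrite !coE [j == i]eq_sym (negbTE ij) /=.
  by move: (_%:R) => b; move: (_%:R) => b'; ring.
by rewrite -scaleNr !shift scaleNr.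
Qed.

(* Gilbarg-Trudinger, section 3.4: compare the odd part of [f] in the j-th
   direction with a harmonic quadratic polynomial on half of a cube.  The
   half cube starts at height h/2, where the neighbour below is the mirror
   image. *)
Lemma discrete_difference_half h f z r M j : 0 < h -> h <= r ->
  (forall y, `|y - z| < r -> dlap h f y = 0) ->
  (forall y, `|y - z| < 3 * r -> `|f y| <= M) ->
  f (z + (h / 2) *: ev R j) - f (z - (h / 2) *: ev R j) <= 4 * n * M * h / r.
Proof.
move=> h0 hr Lf fM.
have r0 : 0 < r by apply: lt_le_trans hr.
have n1 : 1 <= n by rewrite ler1n.
have M0 : 0 <= M.
  by apply: le_trans (normr_ge0 (f z)) _; apply: fM; rewrite subrr normr0 mulr_gt0.
pose s y := reflect_at j z y.
pose q y := \sum_i co i (y - z) ^+ 2.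
pose c y := co j (y - z).
pose a := 2 * M / r ^+ 2.
have a0 : 0 <= a by apply: divr_ge0; [exact: mulr_ge0|exact: sqr_ge0].
(* Discrete harmonic, since q contributes 2 n h^2 and - n c^2 takes it away. Beyond the outer faces
   psi >= a q >= a r^2 = 2 M dominates f y - f (s y). The term n h^2 serves the mirror step: it
   makes psi y + psi (s y) nonnegative when c y = h / 2. *)
pose psi y := a * (q y - n * c y ^+ 2 + 2 * n * r * c y + n * h ^+ 2).
pose F y := f y - f (s y) - psi y.
pose Q : set V := [set y | (forall i, `|co i (y - z)| < r) /\
  exists m : nat, c y = (m%:R + 1 / 2) * h].
have q0 y : 0 <= q y by apply: sumr_ge0 => i _; exact: sqr_ge0.
have psi_ge y : 0 <= c y -> c y <= 2 * r -> a * q y <= psi y.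
  move=> c0 c2; apply: ler_wpM2l => //.
  have : 0 <= n * (c y * (2 * r - c y)) by rewrite !mulr_ge0 // subr_ge0.
  have : 0 <= n * h ^+ 2 by rewrite mulr_ge0 ?sqr_ge0.
  by lra.
have Qnorm y : Q y -> `|y - z| < r by case=> yr _; exact: norm_ltP.
have snorm y : `|s y - z| = `|y - z|.
  have le w : `|s w - z| <= `|w - z|.
    apply: norm_leP => // i; rewrite co_reflect; case: ifP => _;
    by rewrite ?mul1r ?mulN1r ?normrN norm_co.
  by apply/eqP; rewrite eq_le le /= -{1}(reflect_atK j z y) le.
have phiM y : `|y - z| < 3 * r -> f y - f (s y) <= 2 * M.
  move=> yz; have := fM _ yz; have : `|f (s y)| <= M by apply: fM; rewrite snorm.
  by rewrite !ler_norml => /andP[] + + /andP[]; lra.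
have lt3 y : `|y - z| < r -> `|y - z| < 3 * r by move: r0; lra.
have Qc y : Q y -> 0 < c y /\ c y < r.
  move=> [yr [m cm]]; split; last by apply: le_lt_trans (yr j); exact: ler_norm.
  by rewrite cm mulr_gt0 // ltr_wpDl.
have sq y : q (s y) = q y.
  apply: eq_bigr => i _; rewrite co_reflect; case: ifP => _; ring.
have sc y : c (s y) = - c y by rewrite /c co_reflect eqxx; ring.
have FQ : forall y, Q y -> F y <= 0.
  apply: (@discrete_max_principle _ _ h Q F j (`|co j z| + r) (2 * M)) => //.
  - move=> y [yr _]; rewrite -[y](subrK z) coD addrC.
    by apply: le_trans (ler_normD _ _) _; rewrite lerD2l ltW.
  - move=> y Qy; have [cy0 cyr] := Qc _ Qy.
    have := psi_ge y (ltW cy0); have := mulr_ge0 a0 (q0 y).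
    have := phiM _ (lt3 _ (Qnorm _ Qy)); rewrite /F.
    by move=> p1 p2 p3; have := p3 ltac:(move: r0; lra); lra.
  - move=> y Qy _.
    have -> : F = fun y => 1 * (1 * f y + (-1) * f (s y)) + (- a) * (1 * q y +
      1 * ((- n) * co j (y - z) ^+ 2 + 1 * ((2 * n * r) * co j (y - z) + (n * h ^+ 2) * 1))).
      by apply/funext => y'; rewrite /F /psi /c; ring.
    rewrite !(dlap_lin, dlap_co_sqr, dlap_co, dlap_cst) /q dlap_sum.
    under eq_bigr do rewrite dlap_co_sqr.
    rewrite sum_dir_const (Lf _ (Qnorm _ Qy)) (dlap_reflect _ f) Lf; last first.
      by rewrite -/(s y) snorm; exact: Qnorm.
    by rewrite le_eqVlt; apply/orP; left; apply/eqP; ring.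
  - move=> y y' Qy Fy yy'.
    have [cy0 cyr] := Qc _ Qy; have [yr [m cm]] := Qy.
    have y'z : `|y' - z| < r + h.
      rewrite -(subrK y y') -addrA addrC.
      by apply: le_lt_trans (ler_normD _ _) _; rewrite ltr_leD ?Qnorm // neighbor_dist.
    have [[m' cm']|[y's ch]] :
        (exists m' : nat, c y' = (m'%:R + 1 / 2) * h) \/ y' = s y /\ c y = h / 2.
      case: yy' => i.
      have cE b : c (y + b *: ev R i) = c y + b * (j == i)%:R.
        by rewrite /c !coE; ring.
      have [<-|ji] := eqVneq j i; last first.
        by case=> ->; left; exists m; rewrite -?scaleNr cE (negbTE ji) mulr0 addr0.
      rewrite -/c in cE *.
      case=> [->|->].
        left; exists m.+1; rewrite /c !coE eqxx -/(c y) /=.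
        by rewrite -natr1; move: cm; rewrite /c !coE; lra.
      case: m cm => [|m] cm; last first.
        left; exists m; rewrite /c !coE eqxx /=.
        by move: cm; rewrite /c !coE -natr1; lra.
      have ch : c y = h / 2 by rewrite cm; ring.
      right; split=> //; rewrite /s /reflect_at -/(c y) ch; congr (_ - _ *: _).
      by field.
    + have [allr|/existsNP[i /negP]] := pselect (forall i, `|co i (y' - z)| < r).
        by left; split => //; exists m'.
      rewrite -leNgt => ri; right; rewrite /F subr_le0.
      have c0 : 0 <= c y' by rewrite cm' mulr_ge0 ?addr_ge0 // ltW.
      have c2 : c y' <= 2 * r.
        apply: le_trans (ler_norm _) _; apply: le_trans (norm_co _ _) _.
        by move: y'z hr; lra.
      apply: le_trans (phiM _ _) (le_trans _ (psi_ge _ c0 c2)).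
        by move: y'z hr r0; lra.
      have -> : 2 * M = a * r ^+ 2 by rewrite /a; field; rewrite lt0r_neq0.
      apply: ler_wpM2l => //; rewrite /q (bigD1 i) //=.
      rewrite -[leLHS]addr0 lerD ?sumr_ge0 // => [|k _]; last exact: sqr_ge0.
      by rewrite -[leRHS]real_normK ?num_real // lerXn2r // nnegrE ltW.
    (* F (s y) = - F y - (psi y + psi (s y)), which is negative because F y > 0. *)
    + right; move: Fy; rewrite y's /F /s reflect_atK -/(s y).
      have : 0 <= psi y + psi (s y).
        rewrite /psi sq sc ch -mulrDr mulr_ge0 //.
        have := q0 y; have : 0 <= n * h ^+ 2 by rewrite mulr_ge0 ?sqr_ge0.
        by lra.
      by rewrite -/(s y); lra.
have cz b i : co i (z + b *: ev R j - z) = b * (i == j)%:R by rewrite !coE; ring.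
have Qy0 : Q (z + (h / 2) *: ev R j).
  split=> [i|]; last by exists 0%N; rewrite /c cz eqxx /= mulr1; field.
  rewrite cz normrM (ger0_norm (x := h / 2)) ?divr_ge0 ?ltW//.
  by case: eqP => _; rewrite ?normr1 ?normr0; move: h0 hr; lra.
have := FQ _ Qy0; rewrite /F.
have -> : s (z + (h / 2) *: ev R j) = z - (h / 2) *: ev R j.
  by apply: co_inj => i; rewrite !coE eqxx /=; move: ((i == j)%:R) => b; field.
suff : psi (z + (h / 2) *: ev R j) <= 4 * n * M * h / r by lra.
have -> : 4 * n * M * h / r = a * (2 * n * r * h) by rewrite /a; field; rewrite lt0r_neq0.
apply: ler_wpM2l => //.
have -> : q (z + (h / 2) *: ev R j) = (h / 2) ^+ 2.
  rewrite /q (bigD1 j) //= cz eqxx mulr1 big1 ?addr0 // => i ij.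
  by rewrite cz (negbTE ij) mulr0 expr0n.
have -> : c (z + (h / 2) *: ev R j) = h / 2 by rewrite /c cz eqxx mulr1.
have : 0 <= n * (h * (r - h)) by rewrite !mulr_ge0 ?subr_ge0 // ltW.
have : 0 <= (n - 1) * h ^+ 2 by rewrite mulr_ge0 ?subr_ge0 ?sqr_ge0.
by lra.
Qed.

End DifferenceEstimate.

Ltac vec_field := apply: co_inj => ?; rewrite !(coD, coN, coZ); field.

(** * Bounds for forward difference quotients and rounding to a lattice *)

Section ForwardDifference.
Variables (R : realType) (d : nat).
Local Notation V := ('rV[R]_d * R)%type.
Local Notation n := (d.+1%:R : R).
Implicit Types (i j l : option 'I_d) (x y z p : V) (h r M t C : R) (f g : V -> R).

Definition fdiff h j f x : R := (f (x + h *: ev R j) - f x) / h.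

Lemma dlap_fdiff h j f x : dlap h (fdiff h j f) x =
  h^-1 * (dlap h f (x + h *: ev R j) - dlap h f x).
Proof.
rewrite /dlap -sumrB mulr_sumr; apply: eq_bigr => i _.
by rewrite /fdiff [x + _ + h *: ev R j]addrAC [x - _ + h *: ev R j]addrAC; ring.
Qed.

(** The half-step estimate is centred at the midpoint of the step and used for f and for - f. The
    cube has size r / 6 so that 3 (r / 6) + h / 2 stays below r; this gives 24 = 4 * 6. *)
Lemma discrete_difference h f x r M j : 0 < h -> 6 * h <= r ->
  (forall y, `|y - x| < 2 * r -> dlap h f y = 0) ->
  (forall y, `|y - x| < 2 * r -> `|f y| <= M) ->
  forall y, `|y - x| < r -> `|fdiff h j f y| <= 24 * n * M / r.
Proof.
move=> h0 hr Lf fM y yx.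
have r0 : 0 < r by lra.
have sub w : `|w - (y + (h / 2) *: ev R j)| < 3 * (r / 6) -> `|w - x| < 2 * r.
  move=> wz; have -> : w - x = (w - (y + (h / 2) *: ev R j)) + (h / 2) *: ev R j + (y - x).
    by vec_field.
  apply: le_lt_trans (ler_normD _ _) _.
  apply: (@lt_le_trans _ _ (3 * (r / 6) + h / 2 + r)); last by lra.
  rewrite ler_ltD //; apply: le_trans (ler_normD _ _) _; rewrite lerD ?(ltW wz) //.
  by apply: le_trans (norm_ev_scale _ _) _; rewrite ger0_norm; lra.
have half g : (forall w, `|w - x| < 2 * r -> dlap h g w = 0) ->
    (forall w, `|w - x| < 2 * r -> `|g w| <= M) ->
    g (y + h *: ev R j) - g y <= 24 * n * M / r * h.
  move=> Lg gM.
  have := @discrete_difference_half R d h g (y + (h / 2) *: ev R j) (r / 6) M j h0.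
  have -> : y + (h / 2) *: ev R j + (h / 2) *: ev R j = y + h *: ev R j.
    by vec_field.
  rewrite addrK => /(_ _ _ _)/le_trans; apply.
  - by lra.
  - by move=> w wz; apply/Lg/sub; lra.
  - by move=> w wz; apply/gM/sub.
  - by rewrite le_eqVlt; apply/orP; left; apply/eqP; field; rewrite lt0r_neq0.
rewrite /fdiff normrM normfV (gtr0_norm h0) ler_pdivrMr // ler_norml.
apply/andP; split; last exact: half.
rewrite lerNl opprB.
have := half (fun w => (-1) * f w + 0 * f w).
rewrite !mul0r !addr0 !mulN1r opprK [- _ + _]addrC; apply.
- by move=> w wx; rewrite dlap_lin Lf //; ring.
- by move=> w wx; rewrite mul0r addr0 mulN1r normrN fM.
Qed.

(* Each difference quotient costs a factor 2 in the radius. *)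
Lemma discrete_differences h f x r M i j l : 0 < h -> 6 * h <= r ->
  (forall y, `|y - x| < 9 * r -> dlap h f y = 0) ->
  (forall y, `|y - x| < 9 * r -> `|f y| <= M) ->
  let K (s : R) := 24 * n / s in
  forall y, `|y - x| < r ->
  [/\ `|fdiff h i f y| <= K (4 * r) * M,
      `|fdiff h j (fdiff h i f) y| <= K (2 * r) * (K (4 * r) * M) &
      `|fdiff h l (fdiff h j (fdiff h i f)) y| <=
         K r * (K (2 * r) * (K (4 * r) * M))].
Proof.
move=> h0 hr Lf fM K.
have r0 : 0 < r by lra.
have step k (g : V -> R) s A : r <= s -> (forall y, `|y - x| < 2 * s -> `|g y| <= A) ->
    (forall y, `|y - x| < 2 * s -> dlap h g y = 0) ->
    forall y, `|y - x| < s -> `|fdiff h k g y| <= K s * A.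
  move=> rs gA Lg y yx; rewrite /K mulrAC; apply: discrete_difference (yx) => //.
  exact: le_trans rs.
have Lstep k (g : V -> R) s : (forall y, `|y - x| < s + h -> dlap h g y = 0) ->
    forall y, `|y - x| < s -> dlap h (fdiff h k g) y = 0.
  move=> Lg y ys; rewrite dlap_fdiff !Lg ?subrr ?mulr0 //.
    by apply: lt_trans ys _; rewrite ltrDl.
  rewrite addrAC; apply: le_lt_trans (ler_normD _ _) _.
  by rewrite ltr_leD // (le_trans (norm_ev_scale _ _)) // gtr0_norm.
have lt9 s y : s <= 9 * r -> `|y - x| < s -> `|y - x| < 9 * r.
  by move=> s9 ys; apply: lt_le_trans s9.
have b1 : forall y, `|y - x| < 4 * r -> `|fdiff h i f y| <= K (4 * r) * M.
  apply: step; first by lra.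
    by move=> y yx; apply: fM; apply: lt9 yx; lra.
  by move=> y yx; apply: Lf; apply: lt9 yx; lra.
have l1 : forall y, `|y - x| < 5 * r -> dlap h (fdiff h i f) y = 0.
  by apply: Lstep => y yx; apply: Lf; apply: lt9 yx; lra.
have b2 : forall y, `|y - x| < 2 * r ->
    `|fdiff h j (fdiff h i f) y| <= K (2 * r) * (K (4 * r) * M).
  apply: step; first by lra.
    by move=> y yx; apply: b1; apply: lt_le_trans yx _; lra.
  by move=> y yx; apply: l1; apply: lt_le_trans yx _; lra.
have l2 : forall y, `|y - x| < 2 * r -> dlap h (fdiff h j (fdiff h i f)) y = 0.
  by apply: Lstep => y yx; apply: l1; apply: lt_le_trans yx _; lra.
move=> y yx; split.
- by apply: b1; apply: lt_le_trans yx _; lra.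
- by apply: b2; apply: lt_le_trans yx _; lra.
- exact: step yx.
Qed.

Lemma norm_segment (u v : V) r t T : 0 <= t -> t <= T ->
  `|u| < r -> `|u + T *: v| < r -> `|u + t *: v| < r.
Proof.
move=> t0 tT ur uTr.
have [T0|T0] := leP T 0.
  have -> : t = 0 by apply/eqP; rewrite eq_le t0 (le_trans tT).
  by rewrite scale0r addr0.
have -> : u + t *: v = (1 - t / T) *: u + (t / T) *: (u + T *: v).
  rewrite scalerDr addrA -scalerDl subrK scale1r scalerA; congr (_ + _ *: _).
  by field; rewrite lt0r_neq0.
have s0 : 0 <= t / T by rewrite divr_ge0 // ltW.
have s1 : 0 <= 1 - t / T by rewrite subr_ge0 ler_pdivrMr // mul1r.
apply: le_lt_trans (ler_normD _ _) _; rewrite 2!normrZ (ger0_norm s0) (ger0_norm s1).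
have [s0'|s0'] := ltP 0 (t / T).
  have := ler_wpM2l s1 (ltW ur); have : (t / T) * `|u + T *: v| < (t / T) * r by rewrite ltr_pM2l.
  by lra.
have -> : t / T = 0 by apply/eqP; rewrite eq_le s0 andbT.
by rewrite mul0r addr0 subr0 mul1r.
Qed.

(** A telescoping sum over the m steps. *)
Lemma fdiff_lip h f x i m C : 0 < h ->
  (forall k : nat, (k < m)%N -> `|fdiff h i f (x + (k%:R * h) *: ev R i)| <= C) ->
  `|f (x + (m%:R * h) *: ev R i) - f x| <= C * (m%:R * h).
Proof.
move=> h0; elim: m => [|m IH] fC; first by rewrite !mul0r scale0r addr0 subrr normr0 mulr0.
have := fC m (leqnn _); rewrite /fdiff normrM normfV (gtr0_norm h0) ler_pdivrMr //.
have -> : x + (m%:R * h) *: ev R i + h *: ev R i = x + (m.+1%:R * h) *: ev R i.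
  by rewrite -natr1; vec_field.
move=> fm; rewrite -(subrK (f (x + (m%:R * h) *: ev R i)) (f (_ + (m.+1%:R * _) *: _))).
rewrite -addrA; apply: le_trans (ler_normD _ _) _.
move: (IH (fun k km => fC k (ltnW km))) fm; rewrite -natr1; lra.
Qed.

(** Each further step adds h times the increment of the first quotient since x, which [fdiff_lip]
    bounds by C m h; these contributions sum to at most C (m h)^2. *)
Lemma fdiff_taylor h f x i m C : 0 < h ->
  (forall k : nat, (k < m)%N ->
    `|fdiff h i (fdiff h i f) (x + (k%:R * h) *: ev R i)| <= C) ->
  `|f (x + (m%:R * h) *: ev R i) - f x - (m%:R * h) * fdiff h i f x|
    <= C * (m%:R * h) ^+ 2.
Proof.
move=> h0; elim: m => [|m IH] fC.
  by rewrite !mul0r scale0r addr0 subrr subr0 normr0 expr0n mulr0.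
have lip : `|fdiff h i f (x + (m%:R * h) *: ev R i) - fdiff h i f x| <= C * (m%:R * h).
  by apply: fdiff_lip => // k km; apply: fC; exact: ltnW.
have := IH (fun k km => fC k (ltnW km)).
have E : f (x + (m.+1%:R * h) *: ev R i) =
    f (x + (m%:R * h) *: ev R i) + h * fdiff h i f (x + (m%:R * h) *: ev R i).
  rewrite /fdiff; have -> : x + (m%:R * h) *: ev R i + h *: ev R i = x + (m.+1%:R * h) *: ev R i.
    by rewrite -natr1; vec_field.
  by field; rewrite lt0r_neq0.
rewrite E -natr1.
set A := f (x + _); set B := fdiff h i f (x + _); set D := fdiff h i f x.
have -> : A + h * B - f x - (m%:R + 1) * h * D =
  (A - f x - m%:R * h * D) + h * (B - D) by ring.
move=> H; apply: le_trans (ler_normD _ _) _.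
rewrite [`|h * _|]normrM (gtr0_norm h0).
have := ler_wpM2l (ltW h0) lip.
have C0 : 0 <= C by apply: le_trans (fC 0%N _).
have : 0 <= C * (m%:R * h * h) by rewrite !mulr_ge0 // ltW.
have : 0 <= C * (h * h) by rewrite !mulr_ge0 // ltW.
move: H; rewrite -/B -/D; lra.
Qed.

(** The point p rounded down to the lattice h Z^(d+1). Moving p along one axis changes only that
    coordinate of the rounded point, and by whole steps. *)
Definition grid h p : V :=
  \sum_i (h * (Num.floor (co i p / h))%:~R) *: ev R i.

Lemma co_grid h p i : co i (grid h p) = h * (Num.floor (co i p / h))%:~R.
Proof.
rewrite co_sumr (bigD1 i) //= !coE eqxx mulr1 big1 ?addr0 // => j ji.
by rewrite !coE eq_sym (negbTE ji) mulr0.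
Qed.

Lemma grid_dist h p : 0 < h -> `|grid h p - p| <= h.
Proof.
move=> h0; apply: norm_leP => [|i]; first exact: ltW.
rewrite coB co_grid distrC.
have E : co i p = h * (co i p / h) by field; rewrite lt0r_neq0.
rewrite [X in `|X - _|]E -mulrBr normrM (gtr0_norm h0) ler_piMr ?(ltW h0) //.
set a := _ / _; have := floor_le a; have := floorD1_gt a; rewrite intrD => a1 a2.
by rewrite ger0_norm; lra.
Qed.

(** [Num.floor] is monotone, so for t >= 0 the roundings differ by a natural number of steps; each
    rounding loses less than h, whence the error bound. *)
Lemma grid_step h p i t : 0 < h -> 0 <= t -> exists m : nat,
  grid h (p + t *: ev R i) = grid h p + (m%:R * h) *: ev R i /\ `|m%:R * h - t| <= h.
Proof.
move=> h0 t0.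
have : Num.floor (co i p / h) <= Num.floor ((co i p + t) / h).
  by apply: le_floor; rewrite ler_pM2r ?invr_gt0 // lerDl.
rewrite -subr_ge0; case E : (_ - _) => [m|//] _.
have mE : m%:R = (Num.floor ((co i p + t) / h))%:~R - (Num.floor (co i p / h))%:~R :> R.
  by rewrite -intrB E.
exists m; split.
  apply: co_inj => k; rewrite coD !co_grid !coE.
  have [->|ki] := eqVneq k i; last by rewrite !mulr0 !addr0.
  by rewrite /= !mulr1 mE; ring.
rewrite mE ler_norml.
set a := (co i p + t) / h; set b := co i p / h.
have tE : t = (a - b) * h by rewrite /a /b; field; rewrite lt0r_neq0.
have := floor_le a; have := floor_le b.
have := floorD1_gt a; have := floorD1_gt b; rewrite !intrD /=.
set fa := (Num.floor a)%:~R; set fb := (Num.floor b)%:~R => b1 a1 b2 a2.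
have : -1 <= fa - fb - (a - b) <= 1 by lra.
move=> /andP[H1 H2]; have := ler_wpM2r (ltW h0) H1; have := ler_wpM2r (ltW h0) H2.
by rewrite tE; lra.
Qed.

End ForwardDifference.

(** * Differentiability and ultrafilter limits *)

Section Differentiability.
Variables (R : realType) (d : nat).
Local Notation V := ('rV[R]_d * R)%type.
Implicit Types (i j l : option 'I_d) (x y z p w : V) (h r M t C : R) (f g : V -> R).

Lemma sum_dir (F : option 'I_d -> R) : \sum_i F i = \sum_(k < d) F (Some k) + F None.
Proof.
rewrite (bigD1 None) //= addrC; congr (_ + _).
by rewrite (reindex_omap Some id) => [|[]] //=; apply: eq_bigl => k; rewrite eqxx.
Qed.

Lemma laplacianE f p : laplacian f p = \sum_i 'D_(ev R i) ('D_(ev R i) f) p.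
Proof. by rewrite sum_dir. Qed.

(** The difference quotient differs from L by at most A |t|. *)
Lemma derive_of_remainder f p w (L A e : R) : 0 < e ->
  (forall t, `|t| < e -> `|f (p + t *: w) - f p - t * L| <= A * t ^+ 2) ->
  derivable f p w /\ 'D_w f p = L.
Proof.
move=> e0 fA.
suff H : h^-1 *: ((f \o shift p) (h *: w) - f p) @[h --> 0^'] --> L.
  by split; [apply/cvg_ex; exists L|exact/cvg_lim].
have A0 : 0 <= A.
  have := fA (e / 2); have e2 : 0 < (e / 2) ^+ 2 by rewrite exprn_gt0 // divr_gt0.
  rewrite gtr0_norm ?divr_gt0 // => /(_ ltac:(lra)) /(le_trans (normr_ge0 _)).
  by rewrite pmulr_lge0.
apply/cvgrPdist_lt => _/posnumP[eps].
near=> t.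
have t0 : t != 0 by near: t; exact: nbhs_dnbhs_neq.
have -> : L - t^-1 *: ((f \o shift p) (t *: w) - f p) =
    - (t^-1 * (f (p + t *: w) - f p - t * L)).
  by rewrite /= [t *: w + p]addrC /GRing.scale /=; field.
rewrite normrN normrM normfV ltr_pdivrMl ?normr_gt0 //.
have te : `|t| < e.
  by near: t; apply: dnbhs0_lt.
apply: le_lt_trans (fA _ te) _.
rewrite -real_normK ?num_real // expr2 mulrA mulrC ltr_pM2l ?normr_gt0 //.
have tA : `|t| < eps%:num / (A + 1).
  by near: t; apply: dnbhs0_lt; rewrite divr_gt0 // ltr_wpDl.
apply: le_lt_trans (_ : (A + 1) * `|t| < _).
  by rewrite ler_wpM2r // lerDl.
by rewrite mulrC -ltr_pdivlMr // ltr_wpDl.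
Unshelve. all: by end_near. Qed.

(** * Directional derivatives from estimates along the axes *)

Section PartialDerivatives.
Variables (f : V -> R) (G : option 'I_d -> V -> R) (x : V) (r C : R).
Hypothesis G_lip : forall i j p t, `|p - x| < r -> `|p + t *: ev R i - x| < r ->
  `|G j (p + t *: ev R i) - G j p| <= C * `|t|.

Local Notation path w s := (\sum_(i <- s) co i w *: ev R i).

Lemma norm_path w (s : seq (option 'I_d)) : `|path w s| <= (size s)%:R * `|w|.
Proof.
elim: s => [|i s IH]; first by rewrite big_nil normr0 mul0r.
rewrite big_cons (le_trans (ler_normD _ _)) //= -natr1 mulrDl mul1r addrC lerD //.
by apply: le_trans (norm_ev_scale _ _) (norm_co _ _).
Qed.

(** The path from p to p + w changes one coordinate at a time, the head of the list last. A slack of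
    |w| per leg keeps every leg inside the ball. *)
Lemma path_in p w i (s : seq (option 'I_d)) : `|p - x| + (size (i :: s))%:R * `|w| < r ->
  [/\ `|p - x| + (size s)%:R * `|w| < r, `|p + path w s - x| < r &
      `|p + path w s + co i w *: ev R i - x| < r].
Proof.
rewrite /= -natr1 => pr; have w0 := normr_ge0 w.
have H u : p + u - x = (p - x) + u by rewrite addrAC.
split; first by lra.
- rewrite H; apply: le_lt_trans (ler_normD _ _) _; have := norm_path w s; lra.
- rewrite -[p + _ + _]addrA H; apply: le_lt_trans (ler_normD _ _) _.
  have := ler_normD (path w s) (co i w *: ev R i); have := norm_path w s.
  have := le_trans (norm_ev_scale (co i w) i) (norm_co i w); lra.
Qed.

Lemma path_lip j p w (s : seq (option 'I_d)) : 0 <= C ->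
  `|p - x| + (size s)%:R * `|w| < r ->
  `|G j (p + path w s) - G j p| <= C * (size s)%:R * `|w|.
Proof.
move=> C0; elim: s => [|i s IH] pr.
  by rewrite big_nil addr0 subrr normr0 /= mulr0 mul0r.
have [p1 p2 p3] := path_in pr; have := IH p1; have := G_lip j p2 p3.
rewrite big_cons addrA addrAC => H1 H2.
have -> : G j (p + path w s + co i w *: ev R i) - G j p =
  (G j (p + path w s + co i w *: ev R i) - G j (p + path w s)) +
  (G j (p + path w s) - G j p) by ring.
apply: le_trans (ler_normD _ _) _; have := ler_wpM2l C0 (norm_co i w).
by rewrite /= -natr1; lra.
Qed.

Lemma lip_continuous j p : 0 <= C -> `|p - x| < r -> {for p, continuous (G j)}.
Proof.
move=> C0 px; apply/cvgrPdist_lt => _/posnumP[e].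
pose n := (size (index_enum (option 'I_d)))%:R : R.
have n0 : 0 <= n by [].
have M0 : 0 < C * n + 1 by rewrite ltr_wpDl // mulr_ge0.
have n1 : 0 < n + 1 by rewrite ltr_wpDl.
have pos : 0 < Num.min ((r - `|p - x|) / (n + 1)) (e%:num / (C * n + 1)).
  by rewrite lt_min !divr_gt0 // subr_gt0.
near=> q.
have : `|p - q| < Num.min ((r - `|p - x|) / (n + 1)) (e%:num / (C * n + 1)).
  by near: q; apply: cvgr_dist_lt.
rewrite distrC lt_min !ltr_pdivlMr // => /andP[q1 q2].
have w0 := normr_ge0 (q - p).
have -> : q = p + path (q - p) (index_enum (option 'I_d)).
  by rewrite co_basis addrC subrK.
rewrite distrC; apply: le_lt_trans (path_lip _ C0 _) _.
  by rewrite -/n; lra.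
by rewrite -/n; lra.
Unshelve. all: by end_near. Qed.

Hypothesis G_partial : forall i p t, `|p - x| < r -> `|p + t *: ev R i - x| < r ->
  `|f (p + t *: ev R i) - f p - t * G i p| <= C * t ^+ 2.

(** Each leg contributes its own Taylor remainder, and its length times the change of [G i] between
    p and the start of the leg; both are of order |w|^2. *)
Lemma path_taylor p w (s : seq (option 'I_d)) : 0 <= C ->
  `|p - x| + (size s)%:R * `|w| < r ->
  `|f (p + path w s) - f p - \sum_(i <- s) co i w * G i p|
    <= C * (size s)%:R ^+ 2 * `|w| ^+ 2.
Proof.
move=> C0; elim: s => [|i s IH] pr.
  by rewrite !big_nil addr0 subrr subr0 normr0 /= expr0n /= mulr0 mul0r.
have [p1 p2 p3] := path_in pr; have := IH p1; have := G_partial p2 p3.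
have := path_lip i C0 p1.
rewrite !big_cons addrA addrAC.
set q := p + path w s; set a := co i w; set Sg := \sum_(_ <- _) _.
move=> H1 H2 H3.
have -> : f (q + a *: ev R i) - f p - (a * G i p + Sg) =
  (f (q + a *: ev R i) - f q - a * G i q) + (f q - f p - Sg) + a * (G i q - G i p) by ring.
apply: le_trans (ler_normD _ _) _; rewrite [`|a * _|]normrM.
have aw : `|a| <= `|w| := norm_co i w.
have a2 : C * a ^+ 2 <= C * `|w| ^+ 2.
  by apply: ler_wpM2l => //; rewrite -real_normK ?num_real // lerXn2r // nnegrE.
have := ler_normD (f (q + a *: ev R i) - f q - a * G i q) (f q - f p - Sg).
have := ler_pM (normr_ge0 _) (normr_ge0 _) aw H1.
have : 0 <= C * (size s)%:R * `|w| ^+ 2 by rewrite !mulr_ge0 // sqr_ge0.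
by rewrite /= -natr1; lra.
Qed.

Lemma derive_partial p w : 0 <= C -> `|p - x| < r ->
  derivable f p w /\ 'D_w f p = \sum_i co i w * G i p.
Proof.
move=> C0 px; pose n := (size (index_enum (option 'I_d)))%:R : R.
have n0 : 0 <= n by [].
have w0 := normr_ge0 w.
have nw : 0 < n * `|w| + 1 by rewrite ltr_wpDl // mulr_ge0.
apply: (@derive_of_remainder _ _ _ _ (C * n ^+ 2 * `|w| ^+ 2)
  ((r - `|p - x|) / (n * `|w| + 1))).
  by rewrite divr_gt0 ?subr_gt0.
move=> t; rewrite ltr_pdivlMr // => tr.
have := @path_taylor p (t *: w) (index_enum (option 'I_d)) C0.
rewrite co_basis -/n normrZ.
have -> : \sum_(i <- index_enum (option 'I_d)) co i (t *: w) * G i p =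
    t * \sum_i co i w * G i p.
  by rewrite mulr_sumr; apply: eq_bigr => i _; rewrite coZ; ring.
have t0 := normr_ge0 t.
move=> /(_ ltac:(lra)); rewrite exprMn real_normK ?num_real //; lra.
Qed.

End PartialDerivatives.
End Differentiability.

Lemma cvgr_sum (R : realType) (T I : Type) (G : set_system T) (FG : Filter G)
    (s : seq I) (f : I -> T -> R) (l : I -> R) :
  (forall i, f i x @[x --> G] --> l i) ->
  \sum_(i <- s) f i x @[x --> G] --> \sum_(i <- s) l i.
Proof.
move=> fl; elim: s => [|i s IH].
  under eq_cvg do rewrite big_nil.
  by rewrite big_nil; exact: cvg_cst.
under eq_cvg do rewrite big_cons.
by rewrite big_cons; exact: cvgD.
Qed.

Lemma sum_co_ev (R : realType) (d : nat) (A : option 'I_d -> R) i :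
  \sum_j co j (ev R i) * A j = A i.
Proof.
rewrite (bigD1 i) //= co_ev eqxx mul1r big1 ?addr0 // => j ji.
by rewrite co_ev (negbTE ji) mul0r.
Qed.

(** * Limits of discrete functions along an ultrafilter *)

Section UltraLimit.
Variables (R : realType) (d : nat).
Local Notation V := ('rV[R]_d * R)%type.
Local Notation n := (d.+1%:R : R).
Implicit Types (i j l : option 'I_d) (x y z p w : V) (r M t C : R).
Variables (F : set_system nat) (FU : UltraFilter F).
Let FP : ProperFilter F := ultra_proper.
#[local] Existing Instance FP.

(** The values cluster at some l of a compact segment. If the indices with a k close to l did not
    form a set of the ultrafilter, their complement would, against the clustering at l. *)
Lemma ultra_bounded_cvg (a : nat -> R) M :
  (\forall k \near F, `|a k| <= M) -> cvg (a k @[k --> F]).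
Proof.
move=> aM.
have [|l [_ lF]] := @segment_compact R (- M) M (a k @[k --> F]) _.
  by apply: filterS aM => k; rewrite /= in_itv /= ler_norml.
apply/cvg_ex; exists l; apply/cvgrPdist_lt => e e0.
have [//|F'] := in_ultra_setVsetC [set k | `|l - a k| < e] FU.
have [b [/= b1 b2]] := lF (a @` (~` [set k | `|l - a k| < e])) (ball l e)
  (filterS (fun k H => imageP a H) F') (nbhsx_ballx _ _ e0).
by case: b1 => k /= nk ab; case: nk; rewrite ab.
Qed.

Variable h : nat -> R.
Hypothesis h_gt0 : forall k, 0 < h k.
Hypothesis h_cvg0 : h k @[k --> F] --> (0 : R).

Lemma near_step_lt (e : R) : 0 < e -> \forall k \near F, h k < e.
Proof.
move=> e0; have /cvgrPdist_lt/(_ e e0) := h_cvg0; apply: filterS => k /=.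
by rewrite sub0r normrN gtr0_norm.
Qed.

Lemma near_grid p (e : R) : 0 < e -> \forall k \near F, `|grid (h k) p - p| < e.
Proof.
move=> e0; apply: filterS (near_step_lt e0) => k; apply: le_lt_trans.
exact: grid_dist.
Qed.

Lemma near_grid_ball p x r : `|p - x| < r ->
  \forall k \near F, `|grid (h k) p - x| < r.
Proof.
move=> px; have := near_grid p (e := r - `|p - x|); rewrite subr_gt0 => /(_ px).
apply: filterS => k gk; rewrite -(subrK p (grid _ _)) -addrA.
by apply: le_lt_trans (ler_normD _ _) _; lra.
Qed.

(** [lim] has a meaning only if the samples converge; a bound near p guarantees this, by
    [ulim_cvg]. *)
Definition ulim (f : nat -> V -> R) p : R := lim (f k (grid (h k) p) @[k --> F]).

Definition locally_bounded (f : nat -> V -> R) x r C :=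
  \forall k \near F, forall y, `|y - x| < r -> `|f k y| <= C.

Lemma ulim_cvg f x r C p : locally_bounded f x r C -> `|p - x| < r ->
  f k (grid (h k) p) @[k --> F] --> ulim f p.
Proof.
move=> fC px; apply: (@ultra_bounded_cvg _ C).
by apply: filterS2 fC (near_grid_ball px) => k fk gk; exact: fk.
Qed.

Lemma locally_bounded_ge0 f x r C : 0 < r -> locally_bounded f x r C -> 0 <= C.
Proof.
move=> r0 /filter_ex[k /(_ x)]; rewrite subrr normr0 => /(_ r0).
exact: le_trans.
Qed.

Definition ufdiff i (f : nat -> V -> R) k := fdiff (h k) i (f k).

(** The telescoping estimates visit every lattice point between the two roundings; convexity of the
    ball keeps all of them inside. *)
Lemma near_grid_segment p x r i t : 0 <= t ->
  `|p - x| < r -> `|p + t *: ev R i - x| < r ->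
  \forall k \near F, exists m : nat,
   [/\ grid (h k) (p + t *: ev R i) = grid (h k) p + (m%:R * h k) *: ev R i,
       `|m%:R * h k - t| <= h k &
       forall q : nat, (q <= m)%N -> `|grid (h k) p + (q%:R * h k) *: ev R i - x| < r].
Proof.
move=> t0 px ptx.
apply: filterS2 (near_grid_ball px) (near_grid_ball ptx) => k g1 g2.
have [m [gE mh]] := grid_step p i (h_gt0 k) t0; exists m; split => // q qm.
rewrite addrAC; apply: (norm_segment (T := m%:R * h k)) => //.
- by rewrite mulr_ge0 // ltW.
- by rewrite ler_wpM2r ?ler_nat // ltW.
- by rewrite addrAC -gE.
Qed.

Lemma ulim_lip f x r C C' i : 0 < r -> locally_bounded f x r C ->
  locally_bounded (ufdiff i f) x r C' ->
  forall p t, `|p - x| < r -> `|p + t *: ev R i - x| < r ->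
  `|ulim f (p + t *: ev R i) - ulim f p| <= C' * `|t|.
Proof.
move=> r0 fC dC.
have C'0 := locally_bounded_ge0 r0 dC.
have pos p t : 0 <= t -> `|p - x| < r -> `|p + t *: ev R i - x| < r ->
  `|ulim f (p + t *: ev R i) - ulim f p| <= C' * t.
  move=> t0 px ptx.
  have c1 := ulim_cvg fC px; have c2 := ulim_cvg fC ptx.
  (* The rounded increment is at most t + h k, and the excess vanishes in the limit. *)
  have c3 : C' * (t + h k) @[k --> F] --> C' * (t + 0).
    by apply: cvgM; [exact: cvg_cst|apply: cvgD; [exact: cvg_cst|exact: h_cvg0]].
  rewrite addr0 in c3; apply: ler_cvg_to (cvg_norm (cvgB c2 c1)) c3 _.
  apply: filterS2 dC (near_grid_segment t0 px ptx) => k dk [m [gE mh seg]] /=.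
  rewrite !fctE gE; apply: le_trans (fdiff_lip _ _) _ => //.
    by move=> q qm; apply: dk; apply: seg; exact: ltnW.
  apply: ler_wpM2l => //; move: mh; rewrite ler_norml => /andP[_]; lra.
move=> p t px ptx; have [t0|t0] := leP 0 t.
  by rewrite (ger0_norm t0) pos.
have back : p + t *: ev R i + (- t) *: ev R i = p by rewrite scaleNr addrK.
have := pos _ (- t) _ ptx; rewrite back oppr_ge0 => /(_ (ltW t0) px).
by rewrite distrC (ltr0_norm t0).
Qed.

Lemma ulim_taylor f x r C C1 C2 i : 0 < r -> locally_bounded f x r C ->
  locally_bounded (ufdiff i f) x r C1 ->
  locally_bounded (ufdiff i (ufdiff i f)) x r C2 ->
  forall p t, `|p - x| < r -> `|p + t *: ev R i - x| < r ->
  `|ulim f (p + t *: ev R i) - ulim f p - t * ulim (ufdiff i f) p|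
    <= 2 * C2 * t ^+ 2.
Proof.
move=> r0 fC dC ddC.
have C20 := locally_bounded_ge0 r0 ddC.
have pos p t : 0 <= t -> `|p - x| < r -> `|p + t *: ev R i - x| < r ->
  `|ulim f (p + t *: ev R i) - ulim f p - t * ulim (ufdiff i f) p| <= C2 * t ^+ 2.
  move=> t0 px ptx.
  have c1 := ulim_cvg fC px; have c2 := ulim_cvg fC ptx.
  have c3 := ulim_cvg dC px.
  have c4 : C2 * (t + h k) ^+ 2 + h k * `|ufdiff i f k (grid (h k) p)| @[k --> F]
      --> C2 * (t + 0) ^+ 2 + 0 * `|ulim (ufdiff i f) p|.
    apply: cvgD; apply: cvgM.
    - exact: cvg_cst.
    - by apply: cvgM; apply: cvgD; [exact: cvg_cst|exact: h_cvg0|exact: cvg_cst|exact: h_cvg0].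
    - exact: h_cvg0.
    - exact: cvg_norm.
  rewrite addr0 mul0r addr0 in c4.
  apply: ler_cvg_to (cvg_norm (cvgB (cvgB c2 c1) (cvgM (cvg_cst t) c3))) c4 _.
  apply: filterS2 ddC (near_grid_segment t0 px ptx) => k dk [m [gE mh seg]] /=.
  rewrite !fctE gE.
  have := @fdiff_taylor _ _ (h k) (f k) (grid (h k) p) i m C2 (h_gt0 k).
  move=> /(_ (fun q qm => dk _ (seg _ (ltnW qm)))).
  have hk := ltW (h_gt0 k).
  have mhk : 0 <= m%:R * h k by rewrite mulr_ge0.
  move: mh mhk; rewrite /ufdiff; set T := m%:R * h k => mh T0.
  set D := fdiff _ _ _ _; set A := f k (_ + _); set B := f k _ => H.
  (* T is the rounded increment; replacing it by t costs at most h k times the size of the quotient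
     D. *)
  have -> : A - B - t * D = (A - B - T * D) + (T - t) * D by ring.
  apply: le_trans (ler_normD _ _) _; rewrite normrM lerD //; last first.
    by apply: ler_wpM2r.
  apply: le_trans H _; apply: ler_wpM2l => //; rewrite lerXn2r // ?nnegrE ?addr_ge0 //.
  by move: mh; rewrite ler_norml => /andP[_]; lra.
move=> p t px ptx; have [t0|t0] := leP 0 t.
  apply: le_trans (pos _ _ t0 px ptx) _; apply: ler_wpM2r; first exact: sqr_ge0.
  by lra.
(* For t < 0 the expansion is taken at p + t and read backwards; moving the derivative from p + t to
   p costs another C2 t^2, hence the factor 2. *)
have back : p + t *: ev R i + (- t) *: ev R i = p by rewrite scaleNr addrK.
have := pos _ (- t) _ ptx; rewrite back oppr_ge0 => /(_ (ltW t0) px).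
have := ulim_lip r0 dC ddC px ptx; rewrite (ltr0_norm t0).
set A := ulim f (p + _); set B := ulim f p.
set D := ulim (ufdiff i f) (p + _); set E := ulim (ufdiff i f) p.
move=> H1 H2.
have -> : A - B - t * E = - ((B - A - - t * D) - t * (D - E)) by ring.
rewrite normrN; apply: le_trans (ler_normB _ _) _; rewrite [`|t * _|]normrM (ltr0_norm t0).
have := ler_wpM2l (_ : 0 <= - t) H1; rewrite oppr_ge0 => /(_ (ltW t0)).
move: H2; rewrite sqrrN; lra.
Qed.

(** The bounds up to order three make the limits [G] and [H] of first and second quotients Lipschitz
    along the axes, and the Taylor remainders of the limit and of [G] quadratic. Two uses of
    [derive_partial] then identify [G] and [H] as partial derivatives. *)
Lemma ulim_harmonic (u : nat -> V -> R) x r M : 0 < r ->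
  (\forall k \near F, forall y, `|y - x| < 9 * r -> dlap (h k) (u k) y = 0) ->
  locally_bounded u x (9 * r) M ->
  [/\ {for x, continuous (ulim u)},
      forall v w : V, [/\ derivable (ulim u) x v, derivable ('D_v (ulim u)) x w &
        {for x, continuous ('D_w ('D_v (ulim u)))}] &
      laplacian (ulim u) x = 0].
Proof.
move=> r0 Lu uM.
pose K s : R := 24 * n / s.
pose C1 := K (4 * r) * M; pose C2 := K (2 * r) * C1; pose C3 := K r * C2.
have b i j l : \forall k \near F, forall y, `|y - x| < r ->
    [/\ `|ufdiff i u k y| <= C1, `|ufdiff j (ufdiff i u) k y| <= C2 &
        `|ufdiff l (ufdiff j (ufdiff i u)) k y| <= C3].
  have r6 : 0 < r / 6 by rewrite divr_gt0.
  apply: filterS3 Lu uM (near_step_lt r6) => k Lk uk hk y yx.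
  have h6 : 6 * h k <= r by lra.
  exact: (discrete_differences i j l (h_gt0 k) h6 Lk uk yx).
have b0 : locally_bounded u x r M.
  by apply: filterS uM => k uk y yx; apply: uk; lra.
have b1 i : locally_bounded (ufdiff i u) x r C1.
  by apply: filterS (b i i i) => k bk y /bk[].
have b2 i j : locally_bounded (ufdiff j (ufdiff i u)) x r C2.
  by apply: filterS (b i j i) => k bk y /bk[].
have b3 i j l : locally_bounded (ufdiff l (ufdiff j (ufdiff i u))) x r C3.
  by apply: filterS (b i j l) => k bk y /bk[].
have C10 := locally_bounded_ge0 r0 (b1 None).
have C20 := locally_bounded_ge0 r0 (b2 None None).
have C30 := locally_bounded_ge0 r0 (b3 None None None).
pose G i := ulim (ufdiff i u); pose H i j := ulim (ufdiff j (ufdiff i u)).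
have Du p w : `|p - x| < r ->
    derivable (ulim u) p w /\ 'D_w (ulim u) p = \sum_i co i w * G i p.
  apply: (@derive_partial _ _ _ _ _ _ (2 * C2)); last by rewrite mulr_ge0.
  - move=> i j q t qx qtx; apply: le_trans (ulim_lip r0 (b1 j) (b2 j i) qx qtx) _.
    by apply: ler_wpM2r => //; lra.
  - by move=> i q t qx qtx; exact: (ulim_taylor r0 b0 (b1 i) (b2 i i)).
have DG i p w : `|p - x| < r ->
    derivable (G i) p w /\ 'D_w (G i) p = \sum_j co j w * H i j p.
  apply: (@derive_partial _ _ _ _ _ _ (2 * C3)); last by rewrite mulr_ge0.
  - move=> l j q t qx qtx; apply: le_trans (ulim_lip r0 (b2 i j) (b3 i j l) qx qtx) _.
    by apply: ler_wpM2r => //; lra.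
  - by move=> j q t qx qtx; exact: (ulim_taylor r0 (b1 i) (b2 i j) (b3 i j j)).
have xx : `|x - x| < r by rewrite subrr normr0.
have near_x p : `|p - x| < r -> \forall q \near p, `|q - x| < r.
  move=> px; near=> q.
  have : `|p - q| < r - `|p - x|.
    by near: q; apply: cvgr_dist_lt => //; rewrite subr_gt0.
  by have := ler_normD (q - p) (p - x); rewrite addrA subrK [`|q - p|]distrC; lra.
have DDu p v w : `|p - x| < r -> derivable ('D_v (ulim u)) p w /\
    'D_w ('D_v (ulim u)) p = \sum_i co i v * \sum_j co j w * H i j p.
  move=> px.
  have E : {near p, 'D_v (ulim u) =1 (fun q => \sum_i co i v * G i q)}.
    by apply: filterS (near_x _ px) => q qx; have [_ ->] := Du q v qx.
  have E' : {near p, (fun q => \sum_i co i v * G i q) =1 'D_v (ulim u)}.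
    by apply: filterS E => q ->.
  have D : is_derive p w (fun q => \sum_i co i v * G i q)
      (\sum_i co i v * \sum_j co j w * H i j p).
    have [ds dv] : derivable (fun q => \sum_i co i v * G i q) p w /\
        'D_w (fun q => \sum_i co i v * G i q) p =
        \sum_i co i v * 'D_w (G i) p.
      elim: (index_enum _) => [|i s [IH1 IH2]].
        have -> : (fun q => \sum_(i <- [::]) co i v * G i q) = cst (0 : R).
          by apply/funext => q; rewrite big_nil.
        by split; [exact: derivable_cst|rewrite derive_cst big_nil].
      have -> : (fun q => \sum_(j <- i :: s) co j v * G j q) =
          (co i v *: G i) + (fun q => \sum_(j <- s) co j v * G j q).
        by apply/funext => q; rewrite big_cons.
      have [dG _] := DG i p w px.
      have dZ : derivable (co i v *: G i) p w by exact: derivableZ.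
      split; first exact: (derivableD dZ IH1).
      by rewrite (deriveD dZ IH1) (deriveZ _ dG) IH2 big_cons.
    apply: (DeriveDef ds); rewrite dv; apply: eq_bigr => i _.
    by have [_ ->] := DG i p w px.
  split; first by apply: (near_eq_derivable E'); case: D.
  by rewrite (near_eq_derive _ E); case: D.
have cH i j p : `|p - x| < r -> {for p, continuous (H i j)}.
  apply: (@lip_continuous _ _ (fun _ => H i j) x r C3 _ None) => //.
  by move=> l _ q t qx qtx; exact: (ulim_lip r0 (b2 i j) (b3 i j l) qx qtx).
split.
- apply: (@lip_continuous _ _ (fun _ => ulim u) x r C1 _ None) => //.
  by move=> l _ q t qx qtx; exact: (ulim_lip r0 b0 (b1 l) qx qtx).
- move=> v w; have [d1 _] := Du x v xx; have [d2 _] := DDu x v w xx; split; [exact: d1|exact: d2|].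
  have c : {for x, continuous (fun q => \sum_i co i v * \sum_j co j w * H i j q)}.
    apply: cvgr_sum => i; apply: cvgM; first exact: cvg_cst.
    apply: cvgr_sum => j; apply: cvgM; first exact: cvg_cst.
    exact: cH.
  rewrite /prop_for /continuous_at (DDu x v w xx).2; apply: cvg_trans c; apply: near_eq_cvg.
  by apply: filterS (near_x _ xx) => q qx; have [_ ->] := DDu q v w qx.
- rewrite laplacianE.
  have -> : \sum_i 'D_(ev R i) ('D_(ev R i) (ulim u)) x = \sum_i H i i x.
    apply: eq_bigr => i _; have [_ ->] := DDu x (ev R i) (ev R i) xx.
    by rewrite !sum_co_ev.
  have c1 : \sum_i ufdiff i (ufdiff i u) k (grid (h k) x) @[k --> F] -->
      \sum_i H i i x.
    by apply: cvgr_sum => i; exact: (ulim_cvg (b2 i i) xx).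
  apply/eqP; rewrite -normr_eq0 eq_le normr_ge0 andbT.
  have c2 : n * (C3 * h k) @[k --> F] --> n * (C3 * 0).
    by apply: cvgM; [exact: cvg_cst|apply: cvgM; [exact: cvg_cst|exact: h_cvg0]].
  rewrite !mulr0 in c2; apply: ler_cvg_to (cvg_norm c1) c2 _.
  have r2 : 0 < r / 2 by rewrite divr_gt0.
  have gx : \forall k \near F, `|grid (h k) x - x| < r / 2 by exact: near_grid.
  have B3 : \forall k \near F, forall i y, `|y - x| < r ->
      `|ufdiff i (ufdiff i (ufdiff i u)) k y| <= C3.
    have : forall i, \forall k \near F, forall y, `|y - x| < r ->
      `|ufdiff i (ufdiff i (ufdiff i u)) k y| <= C3 by move=> i; exact: b3.
    by move/filter_forall.
  have hr := near_step_lt r2.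
  apply: filterS3 Lu B3 (filterI gx hr) => k Lk Bk [gk hk].
  have h0 := h_gt0 k.
  set y := grid (h k) x in gk *.
  (* Two forward quotients taken at [y - h k *: ev R i] form the centred second difference at y, so
     their sum over i vanishes; the shift back to y costs [C3 * h k] in each direction. *)
  have E i : ufdiff i (ufdiff i u) k (y - h k *: ev R i) =
      (u k (y + h k *: ev R i) + u k (y - h k *: ev R i) - 2 * u k y) / h k ^+ 2.
    rewrite /ufdiff /fdiff subrK; field; exact: lt0r_neq0.
  have S0 : \sum_i ufdiff i (ufdiff i u) k (y - h k *: ev R i) = 0.
    under eq_bigr do rewrite E.
    by rewrite -mulr_suml -/(dlap (h k) (u k) y) Lk ?mul0r //; lra.
  have -> : \sum_i ufdiff i (ufdiff i u) k y = \sum_i (ufdiff i (ufdiff i u) k y -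
      ufdiff i (ufdiff i u) k (y - h k *: ev R i)) by rewrite sumrB S0 subr0.
  apply: le_trans (ler_norm_sum _ _ _) _; rewrite -sum_dir_const.
  apply: ler_sum => i _.
  have := Bk i (y - h k *: ev R i).
  rewrite {1}/ufdiff {1}/fdiff subrK normrM normfV (gtr0_norm h0) ler_pdivrMr //.
  apply; rewrite addrAC; apply: le_lt_trans (ler_normB _ _) _.
  by have := norm_ev_scale (h k) i; rewrite (gtr0_norm h0); lra.
Unshelve. all: by end_near. Qed.

End UltraLimit.

(** * Discrete Perron method *)

Section DiscretePerron.
Variables (R : realType) (d : nat).
Local Notation V := ('rV[R]_d * R)%type.
Local Notation n := (d.+1%:R : R).
Implicit Types (i j l : option 'I_d) (x y z p : V) (h r M t C : R) (f g : V -> R).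

(** In use, [K] is a neighbourhood of the slit, on which w is restricted by 0 <= w <= 1 alone. *)
Definition subsolution h (Q K : set V) (w : V -> R) :=
  [/\ forall x, 0 <= w x <= 1, forall x, ~ Q x -> ~ K x -> w x = 0 &
      forall x, Q x -> 0 <= dlap h w x].

Lemma dlapE h f x : dlap h f x =
  \sum_i (f (x + h *: ev R i) + f (x - h *: ev R i)) - 2 * n * f x.
Proof. by rewrite /dlap big_split /= sumrN sum_dir_const; ring. Qed.

(** Raising the supremum u at one point x to the mean A of its neighbours lowers [dlap] at x only,
    where it stays nonnegative. The result is again a subsolution, so A <= u x. *)
Lemma discrete_perron h (Q K : set V) (w0 : V -> R) : 0 < h ->
  subsolution h Q K w0 ->
  exists u, [/\ subsolution h Q K u, forall x, Q x -> dlap h u x = 0 &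
                forall x, w0 x <= u x].
Proof.
move=> h0 S0.
pose S x := [set w x | w in subsolution h Q K].
pose u x := sup (S x).
have supS x : has_sup (S x).
  by split; [exists (w0 x), w0|exists 1 => _ [w [w01 _ _] <-]; have /andP[] := w01 x].
have le_u w x : subsolution h Q K w -> w x <= u x.
  by move=> Sw; apply: ub_le_sup; [case: (supS x)|exists w].
have u_le x a : (forall w, subsolution h Q K w -> w x <= a) -> u x <= a.
  by move=> wa; apply: ge_sup; [case: (supS x)|move=> _ [w Sw <-]; exact: wa].
have u01 x : 0 <= u x <= 1.
  apply/andP; split; first by apply: le_trans (le_u _ x S0); have [/(_ x)/andP[]] := S0.
  by apply: u_le => w [/(_ x)/andP[]].
have Su : subsolution h Q K u.
  split => // [x nQ nK|x Qx].
    apply/eqP; rewrite eq_le; have /andP[-> _] := u01 x; rewrite andbT.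
    by apply: u_le => w [_ /(_ _ nQ nK) -> _].
  rewrite dlapE subr_ge0 mulrC -ler_pdivlMr //; apply: u_le => w Sw.
  rewrite ler_pdivlMr // mulrC; have [_ _ /(_ _ Qx)] := Sw.
  rewrite dlapE subr_ge0 => /le_trans; apply; apply: ler_sum => i _.
  by rewrite lerD // le_u.
exists u; split=> // [x Qx|x]; last exact: le_u.
apply/eqP; rewrite eq_le; have [_ _ /(_ _ Qx) ->] := Su; rewrite andbT.
pose A := (\sum_i (u (x + h *: ev R i) + u (x - h *: ev R i))) / (2 * n).
pose w y := if pselect (y = x) then A else u y.
have n2 : 0 < 2 * n by rewrite mulr_gt0.
have AE : 2 * n * A = \sum_i (u (x + h *: ev R i) + u (x - h *: ev R i)).
  by rewrite /A mulrC divfK // lt0r_neq0.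
have wx : w x = A by rewrite /w; case: pselect.
have wu y : y <> x -> w y = u y by rewrite /w; case: pselect.
suff Sw : subsolution h Q K w.
  by rewrite dlapE -AE subr_le0 ler_pM2l // -wx le_u.
have uA : u x <= A.
  by have [_ _ /(_ _ Qx)] := Su; rewrite dlapE -AE subr_ge0 ler_pM2l.
have uw y : u y <= w y by have [->|yx] := pselect (y = x); rewrite ?wx ?wu.
split=> [y|y nQ nK|y Qy].
- have [->|yx] := pselect (y = x); last by rewrite wu.
  rewrite wx; apply/andP; split; first by apply: le_trans uA; have /andP[] := u01 x.
  rewrite /A ler_pdivrMr // mul1r [2 * n]mulrC -sum_dir_const.
  apply: ler_sum => i _.
  by have /andP[_] := u01 (x + h *: ev R i); have /andP[_] := u01 (x - h *: ev R i); lra.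
- by have [_ u0 _] := Su; rewrite wu; [exact: u0|move=> yx; apply: nQ; rewrite yx].
- have [->|yx] := pselect (y = x).
    rewrite dlapE wx AE subr_ge0; apply: ler_sum => i _.
    by rewrite lerD // uw.
  have [_ _ /(_ _ Qy)/le_trans] := Su; apply; apply: dlap_le; first by rewrite wu.
  by move=> z _; exact: uw.
Qed.

(** Subtracting the linear part at 0 and A s^2 / 2 from [phi] leaves a function g whose derivative
    has the sign of s, so g h and g (- h) are both at least g 0. *)
Lemma second_difference (phi phi1 phi2 : R -> R) h (A : R) : 0 < h ->
  (forall s : R, `|s| <= h -> is_derive s (1 : R) phi (phi1 s)) ->
  (forall s : R, `|s| <= h -> is_derive s (1 : R) phi1 (phi2 s)) ->
  (forall s, `|s| <= h -> A <= phi2 s) ->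
  A * h ^+ 2 <= phi h + phi (- h) - 2 * phi 0.
Proof.
move=> h0 d1 d2 A2.
have itv_le (a b s : R) : - h <= a -> b <= h -> s \in `[a, b] -> `|s| <= h.
  by rewrite in_itv /= ler_norml => ? ? /andP[? ?]; apply/andP; split; lra.
have mvt (f f' : R -> R) a b : - h <= a -> a < b -> b <= h ->
    (forall s : R, `|s| <= h -> is_derive s (1 : R) f (f' s)) ->
    exists2 c, a < c < b & f b - f a = f' c * (b - a).
  move=> ha ab bh fd.
  have fd' s : s \in `[a, b] -> is_derive s (1 : R) f (f' s).
    by move=> sab; apply: fd; exact: itv_le sab.
  have [|c cab fE] := MVT ab (fun s sab => fd' s (subset_itv_oo_cc sab)).
    by apply: derivable_within_continuous => s /fd'[].
  by exists c; rewrite // -in_itv.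
pose g s := phi s - phi1 0 * s - A / 2 * s ^+ 2.
pose g1 s := phi1 s - phi1 0 - A * s.
have dg s : `|s| <= h -> is_derive s (1 : R) g (g1 s).
  move=> sh; have d1s := d1 s sh.
  apply: is_derive_eq.
  change (phi1 s - phi1 0 * 1 - (A / 2) * (s * 1 + s * 1) = phi1 s - phi1 0 - A * s).
  by field.
have hh s : (`|s| <= h) = (- h <= s <= h) by rewrite ler_norml.
have g1pos c : 0 < c < h -> 0 <= g1 c.
  move=> /andP[c0 ch]; have [||e /andP[e0 ec] E] := mvt phi1 phi2 0 c _ c0 _ d2; try lra.
  rewrite /g1 E subr0 -mulrBl mulr_ge0 ?(ltW c0) // subr_ge0 A2 // hh; apply/andP; split; lra.
have g1neg c : - h < c < 0 -> g1 c <= 0.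
  move=> /andP[c0 ch]; have [||e /andP[e0 ec] E] := mvt phi1 phi2 c 0 _ ch _ d2; try lra.
  have Ae : A <= phi2 e by rewrite A2 // hh; apply/andP; split; lra.
  have : 0 <= (phi2 e - A) * - c by rewrite mulr_ge0 ?subr_ge0 // oppr_ge0 ltW.
  by move: E; rewrite /g1; lra.
have [||a a0h Ea] := mvt g g1 0 h _ h0 _ dg; try lra.
have [|||b b0h Eb] := mvt g g1 (- h) 0 _ _ _ dg; try lra.
have := mulr_ge0 (g1pos _ a0h) (ltW h0); have := g1neg _ b0h.
rewrite -oppr_ge0 => nb; have := mulr_ge0 nb (ltW h0).
by move: Ea Eb; rewrite /g; lra.
Qed.

Lemma is_derive_line f y (e : V) (s : R) : derivable f (y + s *: e) e ->
  is_derive s (1 : R) (fun s => f (y + s *: e)) ('D_e f (y + s *: e)).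
Proof.
have E : (fun h => h^-1 *: (((fun s => f (y + s *: e)) \o shift s) (h *: 1) - f (y + s *: e))) =
    (fun h => h^-1 *: ((f \o shift (y + s *: e)) (h *: e) - f (y + s *: e))).
  apply/funext => h /=; congr (_ *: (f _ - _)).
  by rewrite scalerDl addrCA [h *: 1]mulr1.
move=> fd; apply: DeriveDef; first by rewrite /derivable E.
by rewrite /derive E.
Qed.

(** By continuity each pure second derivative near x exceeds its value at x minus e / n, and the
    values at x sum to 0. The radius r / 2 leaves room for the segments from y to its neighbours. *)
Lemma dlap_harmonic_ge (U : set V) f x (e : R) : open U -> U x -> C2_on U f ->
  laplacian f x = 0 -> 0 < e -> exists2 r, 0 < r &
  forall y h, `|y - x| < r -> 0 < h < r -> - e * h ^+ 2 <= dlap h f y.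
Proof.
move=> oU Ux fU fx e0.
pose D i := 'D_(ev R i) ('D_(ev R i) f).
have en : 0 < e / n by rewrite divr_gt0.
have : \forall y \near x, U y /\ forall i, D i x - e / n < D i y.
  apply: (@filterI _ (nbhs x)); first exact: (open_nbhs_nbhs (conj oU Ux)).
  apply: (@filter_forall _ _ (fun i y => D i x - e / n < D i y) (nbhs x)) => i; have [_ _ c] := fU _ Ux (ev R i) (ev R i).
  have /cvgrPdist_lt/(_ _ en) := c; apply: filterS => y.
  by rewrite /D /= ltr_norml => /andP[_]; rewrite ltrBlDl -ltrBlDr.
move=> /nbhs_normP[r /= r0 xr].
have {}xr y : `|y - x| < r -> U y /\ forall i, D i x - e / n < D i y.
  by move=> yx; apply: xr; rewrite /= distrC.
exists (r / 2); first by rewrite divr_gt0.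
move=> y h yx /andP[h0 hr].
have -> : - e * h ^+ 2 = \sum_i (D i x - e / n) * h ^+ 2.
  rewrite -mulr_suml sumrB sum_dir_const -/(laplacian f x).
  by rewrite /D -laplacianE fx; field; rewrite addrC natr1.
apply: ler_sum => i _.
have inr s : `|s| <= h -> `|y + s *: ev R i - x| < r.
  move=> sh; rewrite addrAC; apply: le_lt_trans (ler_normD _ _) _.
  by have := norm_ev_scale s i; lra.
have := @second_difference (fun s => f (y + s *: ev R i))
  (fun s => 'D_(ev R i) f (y + s *: ev R i)) (fun s => D i (y + s *: ev R i)) h
  (D i x - e / n) h0.
rewrite scale0r addr0 scaleNr; apply.
- move=> s /inr/xr[Us _]; apply: is_derive_line.
  by have [d1 _ _] := fU _ Us (ev R i) (ev R i); exact: d1.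
- move=> s /inr/xr[Us _]; apply: is_derive_line.
  by have [_ d2 _] := fU _ Us (ev R i) (ev R i); exact: d2.
- by move=> s /inr/xr[_ /(_ i)/ltW].
Qed.

End DiscretePerron.

(** * Distance to the complement of a convex set *)

Section NormedTopology.
Variables (R : realType) (W : normedModType R).
Implicit Types (A C : set W) (x y : W).

Lemma open_norm_ball A x : open A -> A x ->
  exists2 r : R, 0 < r & forall y, `|y - x| < r -> A y.
Proof.
move=> oA Ax; have /nbhs_normP[r /= r0 xr] := open_nbhs_nbhs (conj oA Ax).
by exists r => // y yx; apply: xr; rewrite /= distrC.
Qed.

Lemma norm_ball_nbhs (A : set W) x (r : R) : 0 < r ->
  (forall y, `|y - x| < r -> A y) -> nbhs x A.
Proof.
by move=> r0 xA; apply/nbhs_normP; exists r => // y /= yx; apply: xA; rewrite distrC.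
Qed.

Lemma closure_norm_ball A x (r : R) : closure A x -> 0 < r ->
  exists2 y, A y & `|y - x| < r.
Proof.
move=> /(_ [set y | `|y - x| < r]) clA r0.
have [|y [Ay yx]] := clA _; first exact: (norm_ball_nbhs r0).
by exists y.
Qed.

Lemma bounded_setP A : bounded_set A -> exists M : R, forall x, A x -> `|x| <= M.
Proof. by case=> M [_ AM]; exists (M + 1) => x; apply: AM; rewrite ltrDl. Qed.

Lemma bounded_closure A : bounded_set A -> bounded_set (closure A).
Proof.
move=> /bounded_setP[M AM]; exists (M + 1); split; first exact: num_real.
move=> b Mb x /closure_norm_ball/(_ ltr01)[y /AM yM yx].
have : `|x| <= `|y| + `|y - x| by rewrite -{1}[x](subKr y) ler_normB.
move=> xyx /=; lra.
Qed.

(** Compactness in its near-covering form, along h -> 0 from the right, merges the local step bounds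
    without naming a finite subcover. *)
Lemma compact_uniform C (P : W -> R -> Prop) : compact C ->
  (forall x, C x -> exists2 r : R, 0 < r &
     forall y h, `|y - x| < r -> 0 < h < r -> P y h) ->
  exists2 r : R, 0 < r & forall x h, C x -> 0 < h < r -> P x h.
Proof.
move=> /compact_near_coveringP cC PC.
have : \forall h \near (0 : R)^'+, C `<=` (fun x => P x h).
  apply: (cC R ((0 : R)^'+) (fun h x => P x h)) => x /PC[r r0 xr].
  exists ([set y | `|y - x| < r], [set h | 0 < h < r]) => /=.
    split; first exact: (norm_ball_nbhs r0).
    by near=> h => /=; apply/andP; split; near: h; [exact: nbhs_right_gt|exact: nbhs_right_lt].
  by move=> [y h] [/= yx hr]; exact: xr.
rewrite near_withinE => /nbhs_normP[r /= r0 H]; exists r => // x h Cx /andP[h0 hr].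
by apply: H => //=; rewrite sub0r normrN gtr0_norm.
Unshelve. all: by end_near. Qed.

Lemma midpoint_convex A x y : convex_set A -> A x -> A y -> A (2^-1 *: (x + y)).
Proof.
move=> cA Ax Ay.
have h0 : 0 <= (2^-1 : R) by rewrite invr_ge0.
have h1 : (2^-1 : R) <= 1 by rewrite invf_le1 // ler1n.
have := cA x y (Itv01 h0 h1); rewrite !inE => /(_ Ax Ay).
rewrite scalerDr; congr (A (_ + _ *: _)).
by rewrite /= /unstable.onem; field.
Qed.

End NormedTopology.

Section BoundaryDistance.
Variables (R : realType) (W : normedModType R) (D : set W).
Implicit Types (x y a : W) (r : R).
Hypothesis D_open : open D.
Hypothesis D_convex : convex_set D.
Hypothesis D_compl : ~` D !=set0.

(** Taken in the norm of W, which is the sup norm on row vectors: concavity and the Lipschitz bound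
    hold for any norm. [D_compl] keeps the infimum away from the empty set and its default value
    0. *)
Definition bdist x : R := inf [set `|x - y| | y in ~` D].

Lemma bdist_le x y : ~ D y -> bdist x <= `|x - y|.
Proof.
by move=> nDy; apply: ge_inf; [exists 0 => _ [z _ <-]|exists y].
Qed.

Lemma le_bdist x r : (forall y, ~ D y -> r <= `|x - y|) -> r <= bdist x.
Proof.
move=> xr; apply: lb_le_inf => [|_ [y nDy <-]]; last exact: xr.
by have [y nDy] := D_compl; exists `|x - y|, y.
Qed.

Lemma bdist_ge0 x : 0 <= bdist x.
Proof. exact: le_bdist. Qed.

Lemma bdist_lip x y : bdist x <= bdist y + `|x - y|.
Proof.
rewrite -lerBlDr; apply: le_bdist => z nDz; rewrite lerBlDr.
apply: le_trans (bdist_le x nDz) _; rewrite -(subrK y x) -addrA addrC addrK.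
exact: ler_normD.
Qed.

Lemma bdist_in x y : `|x - y| < bdist x -> D y.
Proof. by move=> xy; apply: contrapT => /(bdist_le x); rewrite leNgt xy. Qed.

Lemma bdist_gt0 x : D x -> 0 < bdist x.
Proof.
move=> /(open_norm_ball D_open)[r r0 xr]; apply: lt_le_trans r0 _.
by apply: le_bdist => y nDy; rewrite leNgt distrC; apply/negP => /xr.
Qed.

(* The balls of radius [bdist] around [x + a] and [x - a] lie in D, hence so does
   the ball of the mean radius around the midpoint x. *)
Lemma bdist_midpoint_concave x a : D (x + a) -> D (x - a) ->
  bdist (x + a) + bdist (x - a) <= 2 * bdist x.
Proof.
move=> Dp Dm.
have p0 := bdist_gt0 Dp; have m0 := bdist_gt0 Dm.
set p := bdist (x + a) in p0 *; set m := bdist (x - a) in m0 *.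
rewrite mulrC -ler_pdivrMr //; apply: le_bdist => y nDy.
rewrite leNgt; apply/negP => xy; apply: nDy.
pose s := (p + m) / 2.
have s0 : 0 < s by rewrite divr_gt0 // addr_gt0.
(* With s the mean radius, x + a + (p / s) (y - x) and x - a + (m / s) (y - x) lie in the two balls
   and have midpoint y, because (p + m) / s = 2. *)
have part q b : 0 < q -> q = bdist b -> D (b + (q / s) *: (y - x)).
  move=> q0 qE; apply: (@bdist_in b); rewrite opprD addrA subrr sub0r normrN normrZ.
  rewrite (gtr0_norm (divr_gt0 q0 s0)).
  apply: (@lt_le_trans _ _ q); last by rewrite qE.
  by rewrite mulrAC (ltr_pdivrMr _ _ s0) (ltr_pM2l q0) distrC.
have := midpoint_convex D_convex (part p _ p0 erefl) (part m _ m0 erefl).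
congr D; rewrite addrACA [x + a + _]addrACA subrr addr0 -scalerDl -mulrDl.
have -> : (p + m) / s = 2 by rewrite /s; field; rewrite lt0r_neq0 // addr_gt0.
by rewrite -[x + x]mulr2n -[x *+ 2]scaler_nat -scalerDr scalerA mulVf // scale1r addrC subrK.
Qed.

End BoundaryDistance.

(** * Existence of v_K on a larger domain *)

Lemma slit_open (R : realType) (d : nat) (D K : set 'rV[R]_d) : open D -> closed K ->
  open ((D `*` [set: R]) `\` (K `*` [set 0])).
Proof.
move=> oD cK.
have -> : (D `*` [set: R]) `\` (K `*` [set 0]) =
    (fst @^-1` D) `&` ~` ((fst @^-1` K) `&` (snd @^-1` [set (0 : R)])).
  by apply/seteqP; split=> [p [[Dp _] nK]|p [Dp nK]]; split.
apply: openI; first by apply: open_comp oD => p _; exact: cvg_fst.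
apply: closed_openC; apply: closedI; first by apply: closed_comp cK => p _; exact: cvg_fst.
by apply: closed_comp (@closed_eq _ _) => p _; exact: cvg_snd.
Qed.

Section DiscreteSolution.
Variables (R : realType) (d : nat) (D1 D2 K : set 'rV[R]_d) (v1 : 'rV[R]_d * R -> R).
Local Notation V := ('rV[R]_d * R)%type.
Implicit Types (x y p : V) (z : 'rV[R]_d) (h r e : R).
Hypothesis D1_open : open D1.
Hypothesis D1_bounded : bounded_set D1.
Hypothesis D2_open : open D2.
Hypothesis D2_convex : convex_set D2.
Hypothesis D2_compl : ~` D2 !=set0.
Hypothesis D12 : D1 `<=` D2.
Hypothesis K_closed : closed K.
Hypothesis v1P : is_vK D1 K v1.
Variables (k0 : 'I_d) (B : R).
Hypothesis D2_bound : forall z, D2 z -> `|z| <= B.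
Variable r0 : R.
Hypothesis r0_gt0 : 0 < r0.
Hypothesis K_inner : forall z, K z -> forall y : 'rV[R]_d, `|y - z| < 2 * r0 -> D2 y.

(* Superharmonic, at least 1 on D2 x R and tending to infinity with t: subtracting
   a multiple of it makes v1 negative outside a bounded set. *)
Definition penalty x : R := 2 * B ^+ 2 + 1 - 2 * x.1 ord0 k0 ^+ 2 + x.2 ^+ 2.

Lemma norm_fst x : `|x.1| <= `|x|.
Proof. by rewrite prod_normE le_max lexx. Qed.

Lemma penalty_ge x : `|x.1| <= B -> 1 + x.2 ^+ 2 <= penalty x.
Proof.
move=> xB.
have xk : `|x.1 ord0 k0| <= B.
  apply: le_trans xB; have := norm_co (Some k0) (x.1, 0 : R).
  by rewrite prod_normE normr0 /= (max_idPl _).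
have : x.1 ord0 k0 ^+ 2 <= B ^+ 2.
  rewrite -[leLHS]real_normK ?num_real // lerXn2r // nnegrE //.
  exact: le_trans xB.
by rewrite /penalty; lra.
Qed.

Lemma dlap_penalty h x : dlap h penalty x = - 2 * h ^+ 2.
Proof.
have -> : penalty = fun y => 1 * ((2 * B ^+ 2 + 1) * 1 + (-2) * co (Some k0) (y - 0) ^+ 2)
    + 1 * co None (y - 0) ^+ 2.
  by apply/funext => y; rewrite /penalty !subr0 /=; ring.
by rewrite !(dlap_lin, dlap_cst, dlap_co_sqr); ring.
Qed.

Lemma penalty_continuous : continuous penalty.
Proof.
move=> x; apply: cvgD; last first.
  by apply: (@continuous_comp _ _ _ snd (fun t : R => t ^+ 2)); [exact: cvg_snd|exact: exprn_continuous].
apply: cvgB; first exact: cvg_cst.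
apply: cvgM; first exact: cvg_cst.
apply: (@continuous_comp _ _ _ (fun x : V => x.1 ord0 k0) (fun t : R => t ^+ 2)); last exact: exprn_continuous.
apply: (@continuous_comp _ _ _ fst (fun z : 'rV[R]_d => z ord0 k0)); first exact: cvg_fst.
exact: coord_continuous.
Qed.

Local Notation U1 := ((D1 `*` [set: R]) `\` (K `*` [set 0])).

(** The condition [e * penalty x <= v1 x] bounds t, so x ranges over a compact set. A point of it is
    close to the slit, or has v1 < e * penalty nearby, or is an interior point of harmonicity; the
    first two kinds are excluded by hypothesis. Boundary points of D1 are of the second kind, as v1
    = 0 and penalty >= 1 there. *)
Lemma v1_interior_step e r : 0 < e -> 0 < r ->
  exists2 t : R, 0 < t & forall x h, 0 < h < t -> closure D1 x.1 ->
    e * penalty x <= v1 x -> (forall z, K z -> r <= `|x - (z, 0)|) ->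
  [/\ D1 x.1, forall y, neighbor h x y -> D1 y.1 & - (2 * e) * h ^+ 2 <= dlap h v1 x].
Proof.
move=> e0 rr0; have [v01 v1c [v1C2 v1h] v1b v1K] := v1P.
have cD2 z : closure D1 z -> `|z| <= B.
  move=> clz; rewrite leNgt; apply/negP => Bz.
  have [|y /D12/D2_bound yB yz] := closure_norm_ball clz (_ : 0 < `|z| - B).
    by rewrite subr_gt0.
  have : `|z| <= `|y| + `|y - z| by rewrite -{1}[z](subKr y) ler_normB.
  lra.
have pen1 x : closure D1 x.1 -> 1 + x.2 ^+ 2 <= penalty x by move=> /cD2/penalty_ge.
pose P x h := closure D1 x.1 -> e * penalty x <= v1 x ->
  (forall z, K z -> r <= `|x - (z, 0)|) ->
  [/\ D1 x.1, forall y, neighbor h x y -> D1 y.1 & - (2 * e) * h ^+ 2 <= dlap h v1 x].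
(* Both e T >= 1 and T >= 1, so |x.2| > T would give e * x.2^2 > 1, against e (1 + x.2^2) <= v1 x <=
   1. *)
pose T : R := 1 / e + 1.
have cC : compact (closure D1 `*` [set` `[- T, T]]).
  apply: compact_setX; last exact: segment_compact.
  by apply: bounded_closed_compact; [exact: bounded_closure|exact: closed_closure].
have [|t t0 tP] := @compact_uniform R _ (closure D1 `*` [set` `[- T, T]]) P cC.
  move=> p [/= clp _].
  have [[z Kz pz]|nK] := pselect (exists2 z, K z & `|p - (z, 0)| < r).
    exists (r - `|p - (z, 0)|); first by rewrite subr_gt0.
    move=> x h xp _ _ _ /(_ _ Kz).
    by have := ler_normD (x - p) (p - (z, 0)); rewrite addrA subrK; lra.
  have [vp|vp] := ltP (v1 p) (e * penalty p).
    have /subspace_continuousP/(_ p (conj clp I)) vc := v1c.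
    have c : e * penalty x - v1 x @[x --> within (closure D1 `*` [set: R]) (nbhs p)]
        --> e * penalty p - v1 p.
      apply: cvgB vc; apply: cvg_within_filter; apply: cvgM; first exact: cvg_cst.
      exact: penalty_continuous.
    rewrite -subr_gt0 in vp.
    have /nbhs_normP[s /= s0 H] : \forall x \near p, (closure D1 `*` [set: R]) x ->
        0 < e * penalty x - v1 x by exact: (cvgr_gt _ c _ vp).
    exists s => // x h xp _ clx.
    by have := H x _ (conj clx I); rewrite /= distrC => /(_ xp); lra.
  have Dp : D1 p.1.
    apply: contrapT => nD; have := pen1 _ clp; have p2 := sqr_ge0 p.2.
    rewrite (v1b p) // in vp; move: vp; rewrite pmulr_rle0 //; lra.
  have Up : U1 p.
    split=> // -[/= Kp p0]; apply: nK; exists p.1 => //.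
    by rewrite -p0 -surjective_pairing subrr normr0.
  have e2 : 0 < 2 * e by rewrite mulr_gt0.
  have [s s0 H] := dlap_harmonic_ge (slit_open D1_open K_closed) Up v1C2 (v1h _ Up) e2.
  have [s' s'0 H'] := open_norm_ball D1_open Dp.
  exists (Num.min s (s' / 2)); first by rewrite lt_min s0 divr_gt0.
  move=> x h; rewrite !lt_min => /andP[xs xs'] /and3P[h0 hs hs'] _ _ _.
  have x1 : `|x.1 - p.1| <= `|x - p| by exact: (norm_fst (x - p)).
  split; first by apply: H'; lra.
    move=> y /(neighbor_dist h0) yx; apply: H'.
    have := ler_normD (y.1 - x.1) (x.1 - p.1); rewrite addrA subrK.
    by have := norm_fst (y - x); rewrite /=; lra.
  by apply: H => //; rewrite h0.
exists t => // x h ht clx qv xK; apply: tP => //; split=> //=.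
have /andP[_ v1le] := v01 x (conj clx I).
have := pen1 _ clx => pq; have := ler_wpM2l (ltW e0) pq => pq'.
have x2 : e * x.2 ^+ 2 <= 1 by move: (qv) pq' e0; lra.
rewrite in_itv /= -ler_norml leNgt; apply/negP => Tx.
have T1 : 1 <= T by rewrite /T lerDr divr_ge0 // ltW.
have eT : 1 <= e * T by rewrite /T mulrDr mulr1 mulrC divfK ?lt0r_neq0 // lerDl ltW.
have x2T : T * T < x.2 ^+ 2.
  by rewrite -[ltRHS]real_normK ?num_real // expr2 ltr_pM // (le_trans _ T1).
have := ler_wpM2r (le_trans ler01 T1) eT.
by rewrite -(ltr_pM2l e0) in x2T; move: x2T x2 T1; lra.
Qed.

(** The lower bound is inherited from the initial subsolution [w0]. The upper one is the maximum
    principle for u minus the barrier [bdist D2 x.1 / r0], which is superharmonic on Q and at least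
    1 near the slit, while u = 0 on the rest of D2. *)
Lemma discrete_solution e r eta : 0 < e -> 0 < r -> r <= r0 -> 0 < eta ->
  exists h u, [/\ 0 < h < eta, forall x, 0 <= u x <= 1,
    forall x, D2 x.1 -> (forall y, neighbor h x y -> D2 y.1) ->
      (forall z, K z -> r <= `|x - (z, 0)|) -> dlap h u x = 0,
    forall x, D1 x.1 -> v1 x - e * penalty x <= u x &
    forall x, D2 x.1 -> u x <= bdist D2 x.1 / r0].
Proof.
move=> e0 rr0 rr0' eta0; have [v01 v1c [v1C2 v1h] v1b v1K] := v1P.
have [t t0 tP] := v1_interior_step e0 rr0.
pose h := Num.min t eta / 2.
have h0 : 0 < h by rewrite divr_gt0 // lt_min t0.
have ht : h < Num.min t eta by rewrite /h ltr_pdivrMr // ltr_pMr ?ltr1n // lt_min t0.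
move: ht; rewrite lt_min => /andP[ht heta].
pose N x := exists2 z, K z & `|x - (z, 0)| < r.
(* All neighbours have to be in D2 because [bdist_midpoint_concave] compares points of D2. *)
pose Q x := [/\ D2 x.1, forall y, neighbor h x y -> D2 y.1 & ~ N x].
have nNP x : ~ N x -> forall z, K z -> r <= `|x - (z, 0)|.
  by move=> nN z Kz; rewrite leNgt; apply/negP => xz; apply: nN; exists z.
pose w0 x := if pselect (D1 x.1) then Num.max 0 (v1 x - e * penalty x) else 0.
have w0D x : D1 x.1 -> w0 x = Num.max 0 (v1 x - e * penalty x).
  by rewrite /w0; case: pselect.
have w0N x : ~ D1 x.1 -> w0 x = 0 by rewrite /w0; case: pselect.
have w0_ge0 x : 0 <= w0 x.
  by have [/w0D ->|/w0N ->//] := pselect (D1 x.1); rewrite le_max lexx.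
have w0_pos x : 0 < w0 x -> D1 x.1 /\ w0 x = v1 x - e * penalty x.
  have [D1x|/w0N ->] := pselect (D1 x.1); last by rewrite ltxx.
  rewrite w0D // lt_max ltxx /= => vx; split=> //.
  by rewrite (max_idPr _) // ltW.
have pen0 x : D2 x.1 -> 0 <= penalty x.
  by move=> /D2_bound/penalty_ge; have := sqr_ge0 x.2; lra.
have inside x : 0 < w0 x -> ~ N x -> [/\ w0 x = v1 x - e * penalty x,
    forall y, neighbor h x y -> D1 y.1 & - (2 * e) * h ^+ 2 <= dlap h v1 x].
  move=> wx nN; have [D1x wE] := w0_pos _ wx.
  have hh : 0 < h < t by rewrite h0.
  have vx : e * penalty x <= v1 x by rewrite -subr_ge0 -wE ltW.
  by have [_ nb dl] := tP x h hh (subset_closure D1x) vx (nNP _ nN).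
have w0_sub : subsolution h Q N w0.
  split=> [x|x nQ nN|x [D2x nb nN]].
  - rewrite w0_ge0 /=; have [->//|wx] := eqVneq (w0 x) 0.
    have [|D1x ->] := w0_pos x; first by rewrite lt_neqAle eq_sym wx w0_ge0.
    have /andP[_ v1x] := v01 x (conj (subset_closure D1x) I).
    by have := mulr_ge0 (ltW e0) (pen0 x (D12 D1x)); lra.
  - have [//|wx] := eqVneq (w0 x) 0.
    have {}wx : 0 < w0 x by rewrite lt_neqAle eq_sym wx w0_ge0.
    have [D1x _] := w0_pos _ wx; have [_ nb _] := inside _ wx nN.
    by case: nQ; split=> // [|y /nb/D12//]; exact: D12.
  - have [wx|wx] := eqVneq (w0 x) 0.
      rewrite /dlap wx; apply: sumr_ge0 => i _; rewrite mulr0 subr0.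
      by rewrite addr_ge0.
    have {}wx : 0 < w0 x by rewrite lt_neqAle eq_sym wx w0_ge0.
    have [wE nb1 dl] := inside _ wx nN.
    (* The error - 2 e h^2 allowed for v1 is offset exactly by - e times [dlap_penalty]. *)
    apply: (@le_trans _ _ (dlap h (fun y => 1 * v1 y + (- e) * penalty y) x)).
      by rewrite dlap_lin dlap_penalty; lra.
    apply: dlap_le; first by rewrite wE; ring.
    by move=> y /nb1 D1y; rewrite w0D // le_max; apply/orP; right; rewrite mul1r mulNr.
have [u [[u01 u0 uQ] uh wu]] := discrete_perron h0 w0_sub.
have b0 x : D2 x.1 -> 0 <= bdist D2 x.1 / r0.
  by move=> _; rewrite divr_ge0 ?bdist_ge0 // ltW.
(* Points outside D2 are at distance at least 2 r0 from K, and x.1 is within r <= r0 of K, so the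
   barrier is at least 1 here. *)
have nearK x : N x -> u x <= bdist D2 x.1 / r0.
  move=> [z Kz xz]; apply: (@le_trans _ _ 1); first by have /andP[] := u01 x.
  rewrite ler_pdivlMr // mul1r; apply: le_bdist => // y nDy.
  rewrite leNgt; apply/negP => xy; apply: nDy; apply: (K_inner Kz).
  have : `|x.1 - z| < r by apply: le_lt_trans (norm_fst (x - (z, 0))) xz.
  by have := ler_normD (y - x.1) (x.1 - z); rewrite addrA subrK [`|y - x.1|]distrC; lra.
exists h, u; split=> //.
- by rewrite h0.
- by move=> x D2x nb xK; apply: uh; split=> // -[z /xK]; lra.
- by move=> x D1x; apply: le_trans (wu x); rewrite w0D // le_max lexx orbT.
move=> x D2x.
have [Nx|nNx] := pselect (N x); first exact: nearK.
have [Qx|nQx] := pselect (Q x); last by rewrite u0 ?b0.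
pose f y := 1 * u y + (- r0^-1) * bdist D2 y.1.
suff : f x <= 0 by rewrite /f; lra.
have fE y : f y = u y - bdist D2 y.1 / r0 by rewrite /f; ring.
apply: (@discrete_max_principle _ _ h Q f (Some k0) B 1) => //.
- move=> y [/D2_bound yB _ _]; apply: le_trans yB.
  by have := norm_co (Some k0) (y.1, 0 : R); rewrite prod_normE normr0 /= (max_idPl _).
- move=> y [D2y _ _]; rewrite fE; have := b0 y D2y; have /andP[] := u01 y; lra.
- move=> y Qy _; have [D2y nb _] := Qy; rewrite dlap_lin.
  have -> : dlap h u y = 0 by exact: uh.
  rewrite mulr0 add0r mulNr oppr_ge0 pmulr_rle0 ?invr_gt0 //.
  apply: sumr_le0 => i _; rewrite subr_le0.
  have pE : (y + h *: ev R i).1 = y.1 + (h *: ev R i).1 by [].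
  have mE : (y - h *: ev R i).1 = y.1 - (h *: ev R i).1 by [].
  rewrite pE mE; apply: bdist_midpoint_concave => //.
    by rewrite -pE; apply/nb/neighborD.
  by rewrite -mE; apply/nb/neighborB.
- move=> y y' [D2y nb nN] _ yy'; have D2y' := nb _ yy'.
  have [Qy'|nQ] := pselect (Q y'); first by left.
  right; rewrite fE subr_le0; have [/nearK//|nN'] := pselect (N y').
  by rewrite u0 ?b0.
Qed.

End DiscreteSolution.

(** * Passage to the limit and boundary values *)

Section Existence.
Variables (R : realType) (d : nat).
Local Notation V := ('rV[R]_d * R)%type.
Implicit Types (D K : set 'rV[R]_d) (x y p : V).

Lemma C2_on_eq (U : set V) (f g : V -> R) : open U -> (forall p, U p -> f p = g p) ->
  C2_on U f -> (forall p, U p -> laplacian f p = 0) ->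
  C2_on U g /\ (forall p, U p -> laplacian g p = 0).
Proof.
move=> oU fg fC2 fh.
have nU (P : V -> Prop) p : U p -> (forall q, U q -> P q) -> \forall q \near p, P q.
  by move=> Up UP; apply: filterS (open_nbhs_nbhs (conj oU Up)).
have D1 p v : U p -> 'D_v g p = 'D_v f p.
  by move=> Up; apply: near_eq_derive; apply: nU Up _ => q /fg.
have D2 p v w : U p -> 'D_w ('D_v g) p = 'D_w ('D_v f) p.
  by move=> Up; apply: near_eq_derive; apply: nU Up _ => q /D1.
split=> [p Up v w|p Up]; last first.
  by rewrite /laplacian D2 //; under eq_bigr do rewrite D2 //; exact: fh.
have [d1 d2 c] := fC2 p Up v w; split.
- by apply: near_eq_derivable d1; apply: nU Up _ => q /fg.
- by apply: near_eq_derivable d2; apply: nU Up _ => q /D1.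
- rewrite /prop_for /continuous_at (D2 p v w Up); apply: cvg_trans c.
  by apply: near_eq_cvg; apply: nU Up _ => q Uq; rewrite (D2 q v w Uq).
Qed.

(** A constant vector escapes as soon as there is a coordinate; for d = 0 the whole space is
    bounded. The absolute value covers an empty D, where M may be negative. *)
Lemma bounded_proper D : (0 < d)%N -> bounded_set D -> ~` D !=set0.
Proof.
move=> d0 /bounded_setP[M DM]; pose z : 'rV[R]_d := const_mx (`|M| + 1).
exists z => /DM; apply/negP; rewrite -ltNge; apply: (@lt_le_trans _ _ (`|M| + 1)).
  by have := ler_norm M; lra.
have := norm_co (Some (Ordinal d0)) (z, 0 : R).
rewrite prod_normE normr0 /= (max_idPl _) // mxE ger0_norm //.
Qed.

Lemma exists_vK_ge D1 D2 K (v1 : V -> R) : (0 < d)%N ->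
  bounded_convex_domain D1 -> bounded_convex_domain D2 -> D1 `<=` D2 ->
  compact K -> K `<=` D1 -> is_vK D1 K v1 ->
  exists v2, is_vK D2 K v2 /\ forall p, D1 p.1 -> v1 p <= v2 p.
Proof.
move=> d0 [oD1 _ bD1 _] [oD2 _ bD2 cD2] D12 cK KD1 v1P.
have [v01 v1c _ _ v1K] := v1P.
have nD2 := bounded_proper d0 bD2.
have clK : closed K by apply: compact_closed cK; exact: norm_hausdorff.
have [B D2B] := bounded_setP bD2.
have [r1 r10 r1P] : exists2 r : R, 0 < r &
    forall z r', K z -> 0 < r' < r -> forall y : 'rV[R]_d, `|y - z| < r' -> D2 y.
  apply: (compact_uniform cK) => z /KD1/D12/(open_norm_ball oD2)[r r0 zr].
  exists (r / 2); first by rewrite divr_gt0.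
  move=> z' r' z'z /andP[r'0 r'r] y yz'; apply: zr.
  by have := ler_normD (y - z') (z' - z); rewrite addrA subrK; lra.
pose r0 := r1 / 4.
have r00 : 0 < r0 by rewrite divr_gt0.
have Kin z : K z -> forall y : 'rV[R]_d, `|y - z| < 2 * r0 -> D2 y.
  by move=> Kz; apply: (r1P z (2 * r0) Kz); rewrite /r0; lra.
pose k0 := Ordinal d0.
pose eps (k : nat) : R := k.+1%:R^-1.
have eps0 k : 0 < eps k by rewrite invr_gt0.
have step k : exists hu : R * (V -> R),
   [/\ 0 < hu.1 < eps k, forall x, 0 <= hu.2 x <= 1,
    forall x, D2 x.1 -> (forall y, neighbor hu.1 x y -> D2 y.1) ->
      (forall z, K z -> r0 * eps k <= `|x - (z, 0)|) -> dlap hu.1 hu.2 x = 0,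
    forall x, D1 x.1 -> v1 x - eps k * penalty k0 B x <= hu.2 x &
    forall x, D2 x.1 -> hu.2 x <= bdist D2 x.1 / r0].
  have er0 : 0 < r0 * eps k by rewrite mulr_gt0.
  have er1 : r0 * eps k <= r0 by rewrite ler_piMr ?(ltW r00) // invf_le1 // ler1n.
  have [h [u hu]] := discrete_solution oD1 bD1 oD2 cD2 nD2 D12 clK v1P k0 D2B r00 Kin
    (eps0 k) er0 er1 (eps0 k).
  by exists (h, u).
have [hu huP] := choice step.
pose h k := (hu k).1; pose u k := (hu k).2.
have h0 k : 0 < h k by have [/andP[]] := huP k.
(* [F] refines the filter of eventual properties, so eps k, and with it h k, tends to 0 along
   [F]. *)
have [F [FU Foo]] := ultraFilterLemma (@eventually_filter).
have FP : ProperFilter F := @ultra_proper _ _ FU.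
have eps_lt e : 0 < e -> \forall k \near F, eps k < e.
  by move=> e0; apply: Foo; exact: (near_infty_natSinv_lt (PosNum e0)).
have epsF : eps k @[k --> F] --> (0 : R).
  apply/cvgrPdist_lt => e /eps_lt; apply: filterS => k.
  by rewrite sub0r normrN gtr0_norm.
have hF : h k @[k --> F] --> (0 : R).
  apply/cvgrPdist_lt => e /eps_lt; apply: filterS => k ek.
  rewrite sub0r normrN gtr0_norm //; apply: lt_trans ek.
  by have [/andP[]] := huP k.
pose U := (D2 `*` [set: R]) `\` (K `*` [set 0]).
have oU : open U by exact: slit_open.
have ub x r : locally_bounded F u x r 1.
  apply: filterE => k y _; have [_ /(_ y)/andP[u0 u1] _ _ _] := huP k.
  by rewrite ger0_norm.
pose w := ulim F h u.
have w_cvg p : u k (grid (h k) p) @[k --> F] --> w p.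
  by apply: (ulim_cvg FU h0 hF (ub p 1)); rewrite subrr normr0.
have w01 p : 0 <= w p <= 1.
  apply/andP; split.
    apply: ler_cvg_to (cvg_cst (0 : R)) (w_cvg p) _.
    by apply: filterE => k; have [_ /(_ (grid (h k) p))/andP[]] := huP k.
  apply: ler_cvg_to (w_cvg p) (cvg_cst (1 : R)) _.
  by apply: filterE => k; have [_ /(_ (grid (h k) p))/andP[]] := huP k.
have w_harm p : U p -> [/\ {for p, continuous w},
      forall v v' : V, [/\ derivable w p v, derivable ('D_v w) p v' &
        {for p, continuous ('D_v' ('D_v w))}] &
      laplacian w p = 0].
  move=> Up; have [r r_gt0 rU] := open_norm_ball oU Up.
  (* Here 9 (r / 18) = r / 2; the other half of r absorbs one step h k, or the excluded
     neighbourhood of radius r0 * eps k. *)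
  have r18 : 0 < r / 18 by rewrite divr_gt0.
  have r2 : 0 < r / 2 by rewrite divr_gt0.
  have r3 : 0 < r / 2 / r0 by rewrite divr_gt0.
  apply: (ulim_harmonic FU h0 hF r18 _ (ub _ _)).
  apply: filterS2 (near_step_lt FU h0 hF r2) (eps_lt _ r3) => k hk ek y yp.
  have [_ _ uh _ _] := huP k; apply: uh.
  - by have [[]] : U y by apply: rU; lra.
  - move=> y' /(neighbor_dist (h0 k)) yy'.
    have : U y'.
      apply: rU; have := ler_normD (y' - y) (y - p); rewrite addrA subrK.
      by move: hk yy'; rewrite /h; lra.
    by case; case.
  - move=> z Kz; rewrite leNgt; apply/negP => yz.
    have : U (z, 0).
      apply: rU; have := ler_normD ((z, 0) - y) (y - p); rewrite addrA subrK [`|(z, 0) - y|]distrC.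
      move: ek; rewrite ltr_pdivlMr // mulrC => ek.
      by move: yz ek yp; lra.
    by case=> _; apply.
clearbody w.
have v1p p : D1 p.1 -> v1 x @[x --> p] --> v1 p.
  move=> D1p; have /subspace_continuousP/(_ p (conj (subset_closure D1p) I)) c := v1c.
  have [r r_gt0 rD] := open_norm_ball oD1 D1p.
  move=> A /c /= H.
  apply: filterS2 (norm_ball_nbhs r_gt0 (fun y => id)) H => y yp; apply.
  split=> //; apply: subset_closure; apply: rD.
  exact: le_lt_trans (norm_fst (y - p)) yp.
have gridF p : grid (h k) p @[k --> F] --> p.
  apply/cvgrPdist_lt => e e0; apply: filterS (near_grid FU h0 hF p e0) => k.
  by rewrite distrC.
have w_ge p : D1 p.1 -> v1 p <= w p.
  move=> D1p; have [r r_gt0 rD] := open_norm_ball oD1 D1p.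
  have c1 : v1 (grid (h k) p) - eps k * penalty k0 B (grid (h k) p) @[k --> F] -->
      v1 p - 0 * penalty k0 B p.
    apply: cvgB; first exact: cvg_comp (gridF p) (v1p p D1p).
    by apply: cvgM epsF _; exact: cvg_comp (gridF p) (@penalty_continuous _ _ k0 B p).
  rewrite mul0r subr0 in c1; apply: ler_cvg_to c1 (w_cvg p) _.
  apply: filterS (near_grid FU h0 hF p r_gt0) => k gk.
  have [_ _ _ uk _] := huP k; apply: uk; apply: rD.
  exact: le_lt_trans (norm_fst (grid (h k) p - p)) gk.
have w_le p : D2 p.1 -> w p <= bdist D2 p.1 / r0.
  (* The sample lies within e * r0 of p, so the 1-Lipschitz [bdist] changes the barrier by at most
     e. *)
  move=> D2p; apply/ler_addgt0Pr => e e0; have [r r_gt0 rD] := open_norm_ball oD2 D2p.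
  have er : 0 < e * r0 by rewrite mulr_gt0.
  apply: ler_cvg_to (w_cvg p) (cvg_cst (bdist D2 p.1 / r0 + e)) _.
  apply: filterS2 (near_grid FU h0 hF p r_gt0) (near_grid FU h0 hF p er) => k gk gk'.
  have gp := norm_fst (grid (h k) p - p).
  have [_ _ _ _ uk] := huP k; apply: le_trans (uk _ _) _.
    by apply: rD; exact: le_lt_trans gp gk.
  rewrite ler_pdivrMr // mulrDl divfK ?lt0r_neq0 //.
  apply: le_trans (bdist_lip nD2 _ p.1) _; rewrite lerD2l ltW //.
  exact: le_lt_trans gp gk'.
(* The limit w is kept on U only; on the slit and outside D2 the required values are put in by hand,
   and continuity there rests on [v2_ge] and [v2_le]. *)
pose v2 p := if pselect (U p) then w p else if pselect (K p.1 /\ p.2 = 0) then 1 else 0.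
have v2U p : U p -> v2 p = w p by rewrite /v2; case: pselect.
have v2K p : K p.1 -> p.2 = 0 -> v2 p = 1.
  move=> Kp p0; have nU : ~ U p by case=> _; apply.
  have H : K p.1 /\ p.2 = 0 by [].
  by rewrite /v2; case: pselect => // nU'; case: pselect.
have v2D p : ~ D2 p.1 -> v2 p = 0.
  move=> nD; have nU : ~ U p by case=> -[].
  have nK : ~ (K p.1 /\ p.2 = 0) by case=> /KD1/D12.
  by rewrite /v2; case: pselect => // nU'; case: pselect.
have cases p : [\/ U p, K p.1 /\ p.2 = 0 | ~ D2 p.1].
  have [D2p|] := pselect (D2 p.1); last by constructor 3.
  have [Kp|nK] := pselect (K p.1 /\ p.2 = 0); first by constructor 2.
  by constructor 1; split=> // -[].
clearbody v2.
have v201 p : 0 <= v2 p <= 1.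
  have [Up|[Kp p0]|nD] := cases p; first by rewrite v2U.
    by rewrite v2K // ler01 lexx.
  by rewrite v2D // lexx ler01.
have v2_ge p : D1 p.1 -> v1 p <= v2 p.
  move=> D1p; have [Up|[Kp p0]|nD] := cases p; first by rewrite v2U // w_ge.
    by rewrite v2K //; have /andP[] := v01 p (conj (subset_closure D1p) I).
  by case: nD; exact: D12.
have v2_le p : v2 p <= bdist D2 p.1 / r0.
  have [Up|[Kp p0]|nD] := cases p.
  - by rewrite v2U // w_le //; case: Up => -[].
  - rewrite v2K // ler_pdivlMr // mul1r; apply: le_bdist => // y nDy.
    rewrite leNgt; apply/negP => yp; apply: nDy; apply: (Kin _ Kp).
    by rewrite distrC; apply: lt_trans yp _; lra.
  - by rewrite v2D // divr_ge0 ?bdist_ge0 // ltW.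
have [vC2 vh] : C2_on U v2 /\ (forall p, U p -> laplacian v2 p = 0).
  apply: (@C2_on_eq U w) => // [p Up|p Up|p Up]; first by rewrite v2U.
    by move=> v v'; have [_ /(_ v v')] := w_harm p Up.
  by have [] := w_harm p Up.
exists v2; split=> //; split=> //.
- apply/subspace_continuousP => p [clp _]; apply: cvg_within_filter.
  change (v2 x @[x --> p] --> v2 p).
  have [Up|[Kp p0]|nD] := cases p.
  + have [c _ _] := w_harm p Up.
    rewrite v2U //; apply: cvg_trans c; apply: near_eq_cvg.
    by apply: filterS (open_nbhs_nbhs (conj oU Up)) => q Uq; rewrite v2U.
  + rewrite v2K //.
    have [r r_gt0 rD] := open_norm_ball oD1 (KD1 _ Kp).
    have c := v1p p (KD1 _ Kp); rewrite v1K // in c.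
    apply: squeeze_cvgr c (cvg_cst (1 : R)).
    apply: filterS (norm_ball_nbhs r_gt0 (fun y => id)) => y yp.
    have /andP[_ ->] := v201 y; rewrite andbT; apply: v2_ge; apply: rD.
    exact: le_lt_trans (norm_fst (y - p)) yp.
  + rewrite v2D //; apply/cvgrPdist_lt => e e0.
    have er : 0 < e * r0 by rewrite mulr_gt0.
    apply: filterS (norm_ball_nbhs er (fun y => id)) => y yp.
    have /andP[v20 _] := v201 y; rewrite sub0r normrN ger0_norm //.
    apply: le_lt_trans (v2_le y) _; rewrite ltr_pdivrMr //.
    apply: le_lt_trans (bdist_le _ nD) _.
    exact: le_lt_trans (norm_fst (y - p)) yp.
- by move=> p [[_ nD] _]; exact: v2D.
- by move=> p [Kp p0]; exact: v2K.
Qed.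

End Existence.

(** * Monotonicity *)

Section Monotonicity.
Variables (R : realType) (d : nat).
Local Notation V := ('rV[R]_d * R)%type.
Implicit Types (D K : set 'rV[R]_d) (x y z : 'rV[R]_d).

Lemma enorm_ge0 x : 0 <= enorm x.
Proof. exact: sqrtr_ge0. Qed.

Lemma norm_le_enorm x : `|x| <= enorm x.
Proof.
rewrite [leLHS]/Num.norm /= mx_normrE; apply: bigmax_le => [|[i k] _ /=].
  exact: enorm_ge0.
rewrite (ord1 i) -sqrtr_sqr ler_wsqrtr // (bigD1 k) //= lerDl.
by apply: sumr_ge0 => l _; exact: sqr_ge0.
Qed.

Lemma enormZ (a : R) x : enorm (a *: x) = `|a| * enorm x.
Proof.
rewrite /enorm; under eq_bigr do rewrite mxE exprMn.
by rewrite -mulr_sumr sqrtrM ?sqr_ge0 // sqrtr_sqr.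
Qed.

Lemma edistance_le K x y : K x -> edistance y K <= enorm (y - x).
Proof.
move=> Kx; apply: ge_inf; last by exists x.
by exists 0 => _ [z _ <-]; exact: enorm_ge0.
Qed.

Lemma le_edistance K y (a : R) : K !=set0 -> (forall x, K x -> a <= enorm (y - x)) ->
  a <= edistance y K.
Proof.
move=> [x Kx] aK; apply: lb_le_inf; first by exists (enorm (y - x)), x.
by move=> _ [z Kz <-]; exact: aK.
Qed.

Lemma edistance_gt0 K y : K !=set0 -> closed K -> ~ K y -> 0 < edistance y K.
Proof.
move=> K0 cK nKy; have [r r0 yr] := open_norm_ball (closed_openC cK) nKy.
apply: lt_le_trans r0 _; apply: le_edistance => // x Kx.
apply: le_trans (norm_le_enorm _); rewrite leNgt distrC; apply/negP => /yr; exact.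
Qed.

(** t is the supremum of the times up to which the segment stays in D. Openness of D places the exit
    point outside D, and then t = 0 is impossible because x is in D. *)
Lemma segment_exit D x y : open D -> D x -> ~ D y ->
  exists2 t : R, 0 < t <= 1 & ~ D (x + t *: (y - x)) /\
    forall s, 0 <= s < t -> D (x + s *: (y - x)).
Proof.
move=> oD Dx nDy; pose g (s : R) := x + s *: (y - x).
have g0 : g 0 = x by rewrite /g scale0r addr0.
have g1 : g 1 = y by rewrite /g scale1r addrC subrK.
have gn (s t : R) : `|g s - g t| = `|s - t| * `|y - x|.
  by rewrite /g opprD addrACA subrr add0r -scalerBl normrZ.
have n1 : 0 < `|y - x| + 1 by rewrite ltr_wpDl.
pose S := [set t : R | 0 <= t <= 1 /\ forall s, 0 <= s <= t -> D (g s)].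
have S0 : S 0.
  split; first by rewrite lexx ler01.
  by move=> s; rewrite -eq_le => /eqP <-; rewrite g0.
have supS : has_sup S by split; [exists 0|exists 1 => t [/andP[]]].
have lt_near (r s t : R) : 0 < r -> `|s - t| < r / (`|y - x| + 1) -> `|g s - g t| < r.
  move=> r0; rewrite ltr_pdivlMr // gn; apply: le_lt_trans.
  by rewrite ler_wpM2l // lerDl.
pose T := sup S.
have T1 : T <= 1 by apply: ge_sup; [exists 0|move=> t [/andP[]]].
have T0 : 0 <= T by apply: ub_le_sup => //; case: supS.
have below s : 0 <= s < T -> D (g s).
  move=> /andP[s0 sT]; have [|t [t01 tD] st] := @sup_adherent _ S (T - s) _ supS.
    by rewrite subr_gt0.
  by apply: tD; rewrite s0 /=; move: st; rewrite subKr => /ltW.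
have nDT : ~ D (g T).
  move=> DT; have [r r0 Tr] := open_norm_ball oD DT.
  have rr : 0 < r / (`|y - x| + 1) by rewrite divr_gt0.
  have T1' : T < 1 by rewrite lt_neqAle T1 andbT; apply/eqP => T1'; apply: nDy; rewrite -g1 -T1'.
  pose T' := Num.min 1 (T + r / (`|y - x| + 1) / 2).
  have TT' : T < T' by rewrite /T' lt_min T1' ltrDl divr_gt0.
  have : T' <= T.
    apply: ub_le_sup; first by case: supS.
    split; first by rewrite (le_trans T0 (ltW TT')) /T' ge_min lexx.
    move=> s /andP[s0 sT']; have [sT|Ts] := ltP s T; first by apply: below; rewrite s0.
    apply: Tr; apply: lt_near => //; rewrite ger0_norm ?subr_ge0 //.
    have : T' <= T + r / (`|y - x| + 1) / 2 by rewrite /T' ge_min lexx orbT.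
    by lra.
  by rewrite leNgt TT'.
exists T; last by split.
rewrite T1 andbT lt_neqAle T0 andbT; apply/eqP => T0'.
by apply: nDT; rewrite -T0' g0.
Qed.

Lemma classF_bound D K (lambda : R) (v : V -> R) :
  (ereal_sup [set (`|v (y, 0%R) - 1| / edistance y K `^ 2^-1)%:E | y in D `\` K]
     <= lambda%:E)%E <->
  forall y, D y -> ~ K y -> `|v (y, 0) - 1| / edistance y K `^ 2^-1 <= lambda.
Proof.
split=> [H y Dy nKy|H].
  by rewrite -lee_fin; apply: le_trans H; apply: ereal_sup_ubound; exists y.
by apply: ge_ereal_sup => _ [y [Dy nKy] <-]; rewrite lee_fin; exact: H.
Qed.

(* On the way from K to a point outside D, v drops from 1 to 0 at the boundary of D. *)
Lemma classF_outside D K (lambda : R) (v : V -> R) y :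
  open D -> K !=set0 -> compact K -> K `<=` D -> is_vK D K v -> 0 < lambda ->
  (forall y, D y -> ~ K y -> `|v (y, 0) - 1| / edistance y K `^ 2^-1 <= lambda) ->
  ~ D y -> 1 <= lambda * edistance y K `^ 2^-1.
Proof.
move=> oD K0 cK KD [v01 vc _ vb _] l0 vl nDy.
have clK : closed K by apply: compact_closed cK; exact: norm_hausdorff.
have pow_mono (a b : R) : 0 <= a -> a <= b -> a `^ 2^-1 <= b `^ 2^-1.
  by move=> a0 ab; apply: ge0_ler_powR; rewrite ?nnegrE ?invr_ge0 // (le_trans a0).
(* The bound for a single x reads lambda^-2 <= enorm (y - x); being uniform in x, it passes to the
   infimum without a nearest point. *)
suff H x : K x -> 1 <= lambda * enorm (y - x) `^ 2^-1.
  have l2 : 0 <= (lambda ^-1) ^+ 2 by exact: sqr_ge0.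
  have : (lambda ^-1) ^+ 2 <= edistance y K.
    apply: le_edistance => // x /H Hx.
    have H1 : lambda^-1 <= enorm (y - x) `^ 2^-1 by rewrite -div1r ler_pdivrMr // mulrC.
    have := lerXn2r 2 _ _ H1; rewrite !nnegrE invr_ge0 (ltW l0) powR_ge0 => /(_ isT isT).
    by rewrite -(powR_mulrn _ (powR_ge0 _ _)) -powRrM mulVf // powRr1 // enorm_ge0.
  move=> /(pow_mono _ _ l2) H2; have := ler_wpM2l (ltW l0) H2; apply: le_trans.
  rewrite -powR_mulrn ?invr_ge0 ?(ltW l0) // -powRrM mulfV // powRr1 ?invr_ge0 ?(ltW l0) //.
  by rewrite mulfV // lt0r_neq0.
move=> Kx; have Dx := KD _ Kx.
have [t /andP[t0 t1] [nDt below]] := segment_exit oD Dx nDy.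
pose g (s : R) := x + s *: (y - x).
have gn (s s' : R) : `|g s - g s'| = `|s - s'| * `|y - x|.
  by rewrite /g opprD addrACA subrr add0r -scalerBl normrZ.
have n1 : 0 < `|y - x| + 1 by rewrite ltr_wpDl.
have close (r : R) : 0 < r -> exists2 s, 0 <= s < t & `|g s - g t| < r.
  move=> r0; pose a := Num.min t (r / (`|y - x| + 1) / 2).
  have a0 : 0 < a by rewrite lt_min t0 !divr_gt0.
  have at' : a <= t by rewrite ge_min lexx.
  exists (t - a); first by apply/andP; split; lra.
  rewrite gn addrAC subrr sub0r normrN gtr0_norm //.
  have ar : a <= r / (`|y - x| + 1) / 2 by rewrite ge_min lexx orbT.
  apply: (@le_lt_trans _ _ (a * (`|y - x| + 1))).
    by rewrite ler_wpM2l ?lerDl // ltW.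
  rewrite -ltr_pdivlMr //; apply: le_lt_trans ar _.
  by have : 0 < r / (`|y - x| + 1) by [rewrite divr_gt0|]; lra.
have clt : closure D (g t).
  move=> B /nbhs_normP[r /= r0 rB]; have [s st gs] := close r r0.
  by exists (g s); split; [exact: below|apply: rB; rewrite /= distrC].
have vt : v (g t, 0) = 0 by apply: vb.
have nKt : ~ K (g t) by move=> /KD.
have [r1 r10 r1K] := open_norm_ball (closed_openC clK) nKt.
apply/ler_addgt0Pr => e e0.
have /subspace_continuousP/(_ (g t, 0) (conj clt I)) := vc.
move=> /cvgrPdist_lt/(_ e e0)/nbhs_normP[r2 /= r20 r2v].
(* Just before the exit point |v| < e, so 1 - e <= |v - 1| <= lambda * dist(g s, K)^(1/2), and
   dist(g s, K) <= s * enorm (y - x) <= enorm (y - x). *)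
have [|s st gs] := close (Num.min r1 r2); first by rewrite lt_min r10.
move: gs; rewrite lt_min => /andP[gs1 gs2].
have Ds : D (g s) := below s st.
have nKs : ~ K (g s) by exact: r1K.
have : `|(g t, 0 : R) - (g s, 0)| < r2 -> `|v (g t, 0) - v (g s, 0)| < e.
  by move=> gts; exact: (r2v (g s, 0) gts (conj (subset_closure Ds) I)).
rewrite vt sub0r normrN.
have -> : `|(g t, 0 : R) - (g s, 0)| = `|g s - g t|.
  by rewrite prod_normE /= subrr normr0 distrC; apply/max_idPl.
move=> /(_ gs2) ve.
have d0 := edistance_gt0 K0 clK nKs.
have := vl _ Ds nKs; rewrite ler_pdivrMr ?powR_gt0 //.
have : edistance (g s) K `^ 2^-1 <= enorm (y - x) `^ 2^-1.
  apply: pow_mono; first exact: ltW.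
  apply: le_trans (edistance_le _ Kx) _.
  rewrite /g addrAC subrr add0r enormZ ler_piMl ?enorm_ge0 //.
  by have /andP[s0 st'] := st; rewrite ger0_norm //; lra.
move=> /(ler_wpM2l (ltW l0)).
have : 1 <= `|v (g s, 0)| + `|v (g s, 0) - 1|.
  have := ler_normB (v (g s, 0)) (v (g s, 0) - 1); rewrite opprB addrCA subrr addr0 normr1.
  exact.
by lra.
Qed.

(** The same K serves for D2: on D1 the quotient decreases because v1 <= v2 <= 1, and outside D1 its
    numerator is at most 1. *)
Lemma classF_sub D1 D2 (lambda : R) : (0 < d)%N ->
  bounded_convex_domain D1 -> bounded_convex_domain D2 -> D1 `<=` D2 -> 0 < lambda ->
  classF D1 lambda `<=` classF D2 lambda.
Proof.
move=> d0 bD1 bD2 D12 l0 K [K0 cK KD1 [v1 [v1P /classF_bound vl]]].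
have [oD1 _ _ _] := bD1; have [v101 _ _ _ _] := v1P.
split=> //; first exact: subset_trans D12.
have [v2 [v2P v12]] := exists_vK_ge d0 bD1 bD2 D12 cK KD1 v1P.
exists v2; split=> //; apply/classF_bound => y D2y nKy.
have [v201 _ _ _ _] := v2P.
have /andP[v20 v21] := v201 (y, 0) (conj (subset_closure D2y) I).
have [D1y|nD1y] := pselect (D1 y).
  apply: le_trans (vl y D1y nKy); apply: ler_wpM2r; first by rewrite invr_ge0 powR_ge0.
  have v12y := v12 (y, 0) D1y.
  by rewrite !ler0_norm ?subr_le0 //; [rewrite lerN2 lerB|exact: le_trans v21].
have H := classF_outside oD1 K0 cK KD1 v1P l0 vl nD1y.
have p0 : 0 < edistance y K `^ 2^-1.
  by have := lt_le_trans ltr01 H; rewrite pmulr_rgt0.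
rewrite ler_pdivrMr //; apply: le_trans H.
by rewrite ler0_norm ?subr_le0 //; lra.
Qed.

Lemma LambdaS_anti D1 D2 : (0 < d)%N ->
  bounded_convex_domain D1 -> bounded_convex_domain D2 -> D1 `<=` D2 ->
  (LambdaS D2 <= LambdaS D1)%E.
Proof.
move=> d0 bD1 bD2 D12; apply: le_ereal_inf => _ [l [l0 [K FK]] <-].
by exists l => //; split=> //; exists K; exact: (classF_sub d0 bD1 bD2).
Qed.

End Monotonicity.

(** * Scaling *)

Section Scaling.
Variables (R : realType) (d : nat).
Local Notation V := ('rV[R]_d * R)%type.
Implicit Types (D K : set 'rV[R]_d) (s : R).

Lemma dnbhs0_scale s : s != 0 -> h * s @[h --> (0 : R)^'] --> (0 : R)^'.
Proof.
move=> s0 A /= /nbhs_normP[e /= e0 eA]; apply/nbhs_normP.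
exists (e / `|s|) => /=; first by rewrite divr_gt0 // normr_gt0.
move=> h /=; rewrite sub0r normrN ltr_pdivlMr ?normr_gt0 // => he h0.
by apply: eA; rewrite /= ?sub0r ?normrN ?normrM // mulf_neq0.
Qed.

(** The substitution k = h s preserves punctured neighbourhoods of 0, as s is nonzero. *)
Lemma derive_scale (f : V -> R) p (e : V) s : s != 0 -> derivable f p e ->
  'D_(s *: e) f p = s * 'D_e f p.
Proof.
move=> s0 fd; apply/cvg_lim => //.
have -> : (fun h : R => h^-1 *: ((f \o shift p) (h *: (s *: e)) - f p)) =
  (fun k => s * (k^-1 *: ((f \o shift p) (k *: e) - f p))) \o (fun h => h * s).
  apply/funext => h /=; rewrite scalerA /GRing.scale /=.
  by rewrite mulrA invfM mulrCA mulfV // mulr1.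
apply: (cvg_comp _ _ (dnbhs0_scale s0)).
by apply: cvgM; [exact: cvg_cst|exact: fd].
Qed.

(** The two difference quotients agree before the limit is taken, so this is an equality of
    functions and can be rewritten under a second derivative. *)
Lemma derive_precomp_scale (f : V -> R) (u : V) s :
  'D_u (fun p => f (s *: p)) = (fun p => 'D_(s *: u) f (s *: p)).
Proof.
apply/funext => p; rewrite /derive.
set g := (fun h => h^-1 *: _); set g' := (fun h => h^-1 *: _).
suff -> : g = g' by [].
by apply/funext => h; rewrite /g /g' /= [s *: (_ + _)]scalerDr !scalerA mulrC.
Qed.

Lemma derivable_precomp_scale (f : V -> R) (u : V) p s :
  derivable (fun p => f (s *: p)) p u = derivable f (s *: p) (s *: u).
Proof.
rewrite /derivable.
set g := (fun h => h^-1 *: _); set g' := (fun h => h^-1 *: _).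
suff -> : g = g' by [].
by apply/funext => h; rewrite /g /g' /= [s *: (_ + _)]scalerDr !scalerA mulrC.
Qed.

Lemma laplacian_precomp_scale (U : set V) (f : V -> R) p s : open U -> s != 0 ->
  C2_on U f -> U (s *: p) ->
  laplacian (fun p => f (s *: p)) p = s ^+ 2 * laplacian f (s *: p).
Proof.
move=> oU s0 fC2 Up; rewrite !laplacianE mulr_sumr; apply: eq_bigr => i _.
set e := ev R i; set q := s *: p.
have -> : 'D_e ('D_e (fun p => f (s *: p))) p = 'D_(s *: e) ('D_(s *: e) f) q.
  by rewrite (derive_precomp_scale f); exact: (congr1 (@^~ p) (derive_precomp_scale ('D_(s *: e) f) e s)).
have [_ d1 _] := fC2 q Up (s *: e) e; rewrite (derive_scale s0 d1).
(* The inner derivative is itself differentiated, so the scaling rule has to hold on a whole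
   neighbourhood of q. *)
have -> : 'D_e ('D_(s *: e) f) q = 'D_e (s *: 'D_e f) q.
  apply: near_eq_derive; apply: filterS (open_nbhs_nbhs (conj oU Up)) => q' Uq'.
  by have [d2 _ _] := fC2 q' Uq' e e; rewrite (derive_scale s0 d2).
have [_ d3 _] := fC2 q Up e e.
by rewrite deriveZ // /GRing.scale /= expr2 mulrA.
Qed.

Lemma image_scaleE D s x : s != 0 -> [set s *: x | x in D] x <-> D (s^-1 *: x).
Proof.
move=> s0; split=> [[z Dz <-]|Dx]; first by rewrite scalerA mulVf // scale1r.
by exists (s^-1 *: x) => //; rewrite scalerA mulfV // scale1r.
Qed.

Lemma closure_scale D s x : 0 < s -> closure [set s *: x | x in D] x ->
  closure D (s^-1 *: x).
Proof.
move=> s0 clx B /nbhs_normP[r /= r0 rB].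
have [|_ [z Dz <-] zx] := closure_norm_ball clx (_ : 0 < s * r).
  by rewrite mulr_gt0.
exists z; split=> //; apply: rB => /=.
rewrite -(ltr_pM2l s0); apply: le_lt_trans zx.
rewrite -[X in X * _](gtr0_norm s0) -normrZ scalerBr scalerA mulfV ?lt0r_neq0 //.
by rewrite scale1r distrC.
Qed.

Lemma is_vK_scale D K (v : V -> R) s : open D -> closed K -> 0 < s -> is_vK D K v ->
  is_vK [set s *: x | x in D] [set s *: x | x in K] (fun p => v (s^-1 *: p)).
Proof.
move=> oD cK s0 [v01 vc [vC2 vh] vb vK].
have sn : s != 0 by rewrite lt0r_neq0.
have sVn : s^-1 != 0 by rewrite invr_neq0.
have oU := slit_open oD cK.
have toU p : (([set s *: x | x in D] `*` [set: R]) `\` ([set s *: x | x in K] `*` [set 0])) p ->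
    ((D `*` [set: R]) `\` (K `*` [set 0])) (s^-1 *: p).
  move=> [[/(image_scaleE _ _ sn) Dp _] nK]; split=> // -[/= Kp p0]; apply: nK; split.
    exact/(image_scaleE _ _ sn).
  by move/eqP: p0; rewrite /= mulf_eq0 (negbTE sVn) => /eqP.
have scale_cvg (p : V) : s^-1 *: q @[q --> p] --> s^-1 *: p.
  exact: (@scaler_continuous _ _ s^-1 p).
have toC p : (closure [set s *: x | x in D] `*` [set: R]) p ->
    (closure D `*` [set: R]) (s^-1 *: p).
  by move=> [/(closure_scale s0)].
split.
- by move=> p /toC/v01.
- apply/subspace_continuousP => p Cp A.
  have /subspace_continuousP/(_ _ (toC p Cp)) c := vc.
  move=> /c H.
  change (nbhs p (fun q => (closure [set s *: x | x in D] `*` [set: R]) q -> A (v (s^-1 *: q)))).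
  have H' : nbhs p (fun q => (closure D `*` [set: R]) (s^-1 *: q) -> A (v (s^-1 *: q))).
    exact: (scale_cvg p _ H).
  by apply: filterS H' => q Hq /toC/Hq.
- split=> [p /toU Up u w|p /toU Up].
    have [d1 d2 c] := vC2 _ Up (s^-1 *: u) (s^-1 *: w); split.
    + by rewrite derivable_precomp_scale; exact: d1.
    + by rewrite derive_precomp_scale (derivable_precomp_scale ('D_(s^-1 *: u) v)).
    + rewrite derive_precomp_scale (derive_precomp_scale ('D_(s^-1 *: u) v)).
      exact: (@continuous_comp _ _ _ (fun q : V => s^-1 *: q)
        ('D_(s^-1 *: w) ('D_(s^-1 *: u) v)) p (scale_cvg p) c).
  by rewrite (laplacian_precomp_scale oU sVn vC2 Up) vh // mulr0.
- move=> p [[/(closure_scale s0) clp nD] _]; apply: vb; split=> //; split=> // Dp.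
  by apply: nD; exact/(image_scaleE _ _ sn).
- move=> p [/(image_scaleE _ _ sn) Kp p0]; apply: vK; split=> //=.
  by rewrite p0; exact: mulr0.
Qed.

(** Precomposition with s^-1 keeps the numerator, and the distance to K is multiplied by s, so each
    quotient gains the factor s^(-1/2). *)
Lemma classF_scale D K (lambda : R) s : open D -> 0 < s ->
  classF D lambda K ->
  classF [set s *: x | x in D] (s `^ (- 2^-1) * lambda) [set s *: x | x in K].
Proof.
move=> oD s0 [K0 cK KD [v [vP /classF_bound vl]]].
have sn : s != 0 by rewrite lt0r_neq0.
have clK : closed K by apply: compact_closed cK; exact: norm_hausdorff.
split.
- by have [x Kx] := K0; exists (s *: x), x.
- by apply: continuous_compact cK; apply: continuous_subspaceT; exact: scaler_continuous.
- by move=> _ [x Kx <-]; exists x => //; exact: KD.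
exists (fun p => v (s^-1 *: p)); split; first exact: is_vK_scale.
apply/(@classF_bound R d _ _ _ (fun p => v (s^-1 *: p))) => y /(image_scaleE _ _ sn) Dy nKy.
have {}nKy : ~ K (s^-1 *: y) by move=> Ky; apply: nKy; exact/(image_scaleE _ _ sn).
have d0 := edistance_gt0 K0 clK nKy.
set a := edistance (s^-1 *: y) K in d0.
have sa : s * a <= edistance y [set s *: x | x in K].
  apply: le_edistance; first by have [x Kx] := K0; exists (s *: x), x.
  move=> _ [x Kx <-]; have -> : y - s *: x = s *: (s^-1 *: y - x).
    by rewrite scalerBr scalerA mulfV // scale1r.
  by rewrite enormZ (gtr0_norm s0) ler_pM2l // edistance_le.
have sa0 : 0 < s * a by rewrite mulr_gt0.
have pw : (s * a) `^ 2^-1 <= edistance y [set s *: x | x in K] `^ 2^-1.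
  apply: ge0_ler_powR; rewrite ?nnegrE ?invr_ge0 //; first exact: ltW.
  exact: le_trans (ltW sa0) sa.
have := vl _ Dy nKy; rewrite -/a => va.
have -> : s^-1 *: (y, 0 : R) = (s^-1 *: y, 0) by congr pair; exact: mulr0.
set A := `|_ - 1| in va *.
have A0 : 0 <= A := normr_ge0 _.
have s2 := powR_gt0 2^-1 s0; have a2 := powR_gt0 2^-1 d0.
rewrite powRN [leRHS]mulrC ler_pdivlMr //; apply: le_trans va.
rewrite powRM ?(ltW s0) ?(ltW d0) // in pw.
suff quot (b c f : R) : 0 < c -> 0 < f -> c * f <= b -> A / b * c <= A / f.
  exact: quot s2 a2 pw.
move=> c0 f0 cfb; have b0 := lt_le_trans (mulr_gt0 c0 f0) cfb.
by rewrite mulrAC (ler_pdivrMr _ _ b0) mulrAC (ler_pdivlMr _ _ f0) -mulrA ler_wpM2l.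
Qed.

Lemma LambdaS_scale_le D s : open D -> 0 < s ->
  (LambdaS [set s *: x | x in D] <= (s `^ (- 2^-1))%:E * LambdaS D)%E.
Proof.
move=> oD s0; have c0 : 0 < s `^ (- 2^-1) by rewrite powR_gt0.
rewrite -lee_pdivrMl //; apply: le_ereal_inf_tmp => _ [l [l0 [K FK]] <-].
rewrite lee_pdivrMl // -EFinM; apply: ereal_inf_lbound.
exists (s `^ (- 2^-1) * l) => //; split; first by rewrite mulr_gt0.
by exists [set s *: x | x in K]; exact: classF_scale.
Qed.

(** The reverse inequality is [LambdaS_scale_le] for the scaled set and the factor s^-1. *)
Lemma LambdaS_scale D s : open D -> 0 < s ->
  LambdaS [set s *: x | x in D] = ((s `^ (- 2^-1))%:E * LambdaS D)%E.
Proof.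
move=> oD s0; have sn : s != 0 by rewrite lt0r_neq0.
apply/eqP; rewrite eq_le LambdaS_scale_le //=.
have osD : open [set s *: x | x in D].
  have -> : [set s *: x | x in D] = (fun x => s^-1 *: x) @^-1` D.
    by apply/seteqP; split=> x /(image_scaleE _ _ sn).
  by apply: open_comp oD => x _; exact: scaler_continuous.
have sV : 0 < s^-1 by rewrite invr_gt0.
have := LambdaS_scale_le osD sV.
have -> : [set s^-1 *: x | x in [set s *: x | x in D]] = D.
  apply/seteqP; split=> [_ [_ [x Dx <-] <-]|x Dx].
    by rewrite scalerA mulVf // scale1r.
  by exists (s *: x); [exists x|rewrite scalerA mulVf // scale1r].
have c0 : 0 < (s^-1) `^ (- 2^-1) by rewrite powR_gt0.
rewrite -lee_pdivrMl //; congr (_ <= _)%E; congr (_%:E * _)%E.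
rewrite powRN invrK -powR_inv1 ?(ltW s0) // -powRrM mulN1r.
by [].
Qed.

End Scaling.

Theorem proposition1p13 (R : realType) (d : nat) (hd : (2 <= d)%N) :
  (forall D1 D2 : set 'rV[R]_d,
     bounded_convex_domain D1 -> bounded_convex_domain D2 -> D1 `<=` D2 ->
     (LambdaS D2 <= LambdaS D1)%E)
  /\
  (forall (D : set 'rV[R]_d) (s : R), bounded_convex_domain D -> 0 < s ->
     LambdaS [set s *: x | x in D] = ((s `^ (- 2^-1))%:E * LambdaS D)%E).
Proof.
split=> [D1 D2 bD1 bD2|D s [oD _ _ _]]; last exact: LambdaS_scale.
exact: (LambdaS_anti (ltnW hd)).
Qed.
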